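(* Let $\Psi$ be an $(M_\Psi,\nu)$-self-concordant barrier for $\mathcal K$ and let $\Phi(\cdot)=\Psi(\cdot)+\frac{\nu}{2R^2}\|\cdot\|^2$. Further, let $G,R>0$ and suppose that $\mathcal K\subseteq\mathcal B(R)$ and that for all $t\in[T]$, $\|g_t\|\le G$, where $g_t\in\partial\ell_t(w_t)$ and $(w_t)$ are the iterates of BARONS (run with $\Phi$, which is self-concordant with constant $M_\Phi=M_\Psi$) with input parameters $(\eta,\varepsilon,\alpha,m_{\mathrm{Newton}})$ such that $$\eta=\frac{\nu}{RG}\sqrt{\frac{\log T+1}{T}},\quad\varepsilon=\sqrt{\frac{\nu}{T}},\quad\alpha=0.001,\quad m_{\mathrm{Newton}}=\Theta\Big(\log\frac1{\varepsilon M_\Psi}\Big).$$ For $T\ge1$ large enough such that $\eta\le\frac{1}{1000GM_\Psi}$ and $\varepsilon\le\frac1{20000M_\Psi}$, the regret of BARONS is bounded as $$\sum_{t=1}^T(\ell_t(w_t)-\ell_t(w))\lesssim RG\sqrt{T\log T}\qquad\text{for all }w\in\operatorname{int}\mathcal K.$$ Further, the computational complexity of BARONS in this case is bounded by $$O\Big((\mathcal C^{\mathrm{grad}}_\varepsilon(\Psi)+d^2)\cdot T\cdot\log\frac{T}{\nu M_\Psi}+\mathcal C^{\mathrm{hess}}_\alpha(\Psi)\cdot M_\Psi\sqrt{T\nu\log T}\Big).$$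
   Context: **Online convex optimization.** $\mathcal K\subset\mathbb R^d$ is a convex compact set with non-empty interior $\operatorname{int}\mathcal K$. At each round $t=1,\dots,T$ the learner plays $w_t\in\mathcal K$ based on the history $\{(\ell_s,w_s)\}_{s<t}$; an adaptive adversary, knowing the history and $w_t$, picks a convex loss $\ell_t:\mathcal K\to\mathbb R$. **Notation.** $\|\cdot\|$ is the Euclidean norm and $\mathcal B(R)$ the Euclidean ball of radius $R$ centered at $0$. For a positive definite matrix $A$, $\|x\|_A=\sqrt{x^\top Ax}$. $\nabla^{-2}\Phi=(\nabla^2\Phi)^{-1}$. $f\lesssim g$ means $f\le Cg$ for a universal constant $C>0$; $O(\cdot)$ hides universal constants. $m=\Theta(x)$ means that $m$ is an integer between $c_1x$ and $c_2x$ for suitable universal constants $0<c_1\le c_2$. **Self-concordance.** A convex $C^3$ function $f:\operatorname{int}\mathcal K\to\mathbb R$ is self-concordant with constant $M_f\ge0$ if $f(x_k)\to+\infty$ whenever $x_k\to x\in\partial\mathcal K$, and $|\nabla^3f(x)[u,u,u]|\le2M_f\|u\|^3_{\nabla^2f(x)}$ for all $x\in\operatorname{int}\mathcal K$, $u\in\mathbb R^d$. It is an $(M_f,\nu)$-self-concordant barrier for $\mathcal K$ if moreover $\nabla f(w)^\top\nabla^{-2}f(w)\nabla f(w)\le\nu$ for all $w\in\operatorname{int}\mathcal K$. **Oracles.** For a self-concordant $F$, the gradient oracle $\mathcal O^{\mathrm{grad}}_\varepsilon(F)$, given $w\in\operatorname{int}\mathcal K$, returns a vector $\widehat\nabla_w$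 with $\|\widehat\nabla_w-\nabla F(w)\|_{\nabla^{-2}F(w)}\le\varepsilon$; $\mathcal C^{\mathrm{grad}}_\varepsilon(F)$ is the computational cost of one call. The Hessian oracle $\mathcal O^{\mathrm{hess}}_\alpha(F)$, given $w\in\operatorname{int}\mathcal K$, returns a matrix $H$ and its inverse $H^{-1}$ with $(1-\alpha)\nabla^2F(w)\preceq H\preceq(1+\alpha)\nabla^2F(w)$ and $(1-\alpha)\nabla^{-2}F(w)\preceq H^{-1}\preceq(1+\alpha)\nabla^{-2}F(w)$; $\mathcal C^{\mathrm{hess}}_\alpha(F)$ is the computational cost of one call. A gradient (resp. Hessian) oracle for $\Phi=\Psi+\frac{\nu}{2R^2}\|\cdot\|^2$ is implemented with one call to the gradient (resp. Hessian) oracle for $\Psi$ plus $d$ arithmetic operations. **Algorithm BARONS** (parameters $\eta,\varepsilon,\alpha>0$, $m_{\mathrm{Newton}}\ge1$; gradient and Hessian oracles for the self-concordant function $\Phi$ with constant $M_\Phi>0$; $w^\star\in\arg\min_{w\in\mathcal K}\Phi(w)$). Initialize $u_1=w_1=w^\star$, $H_1=\mathcal O^{\mathrm{hess}}_\alpha(w^\star)$, $s_0=0$, where the oracles are those of $\Phi$. For $t=1,\dots,T$: 1. Play $w_t$, observe $g_t\in\partial\ell_t(w_t)$; set $s_t=s_{t-1}+\eta g_t$ and $w^1_{t+1}=w_t$. 2. For $m=1,\dots,m_{\mathrm{Newton}}-1$: set $\widehat\nabla^m_{t+1}=\mathcal O^{\mathrm{grad}}_\varepsilon(w^m_{t+1})$,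 $\widetilde\nabla^m_{t+1}=\widehat\nabla^m_{t+1}+s_t$, $w^{m+1}_{t+1}=w^m_{t+1}-H_t^{-1}\widetilde\nabla^m_{t+1}$. 3. Set $w_{t+1}=w^{m_{\mathrm{Newton}}}_{t+1}$. 4. If $\|w_{t+1}-u_t\|_{H_t}\le1/(41M_\Phi)$, set $u_{t+1}=u_t$, $H_{t+1}=H_t$, $H_{t+1}^{-1}=H_t^{-1}$. Otherwise set $u_{t+1}=w_{t+1}$ and obtain $H_{t+1},H_{t+1}^{-1}$ from $\mathcal O^{\mathrm{hess}}_\alpha(u_{t+1})$.
   Formalization: Two conditions are added, without which the statement fails: η ≤ √ν/(1000·R·G·M_Ψ), in addition to η ≤ 1/(1000·G·M_Ψ), since otherwise a Newton step can leave K; and, for the complexity bound only, ν ≤ T, since otherwise log(T/(νM_Ψ)) can be negative. *)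

(* Defs.v *)
(* MathComp + MathComp-Analysis. *)
From HB Require Import structures.
From mathcomp Require Import all_boot all_order all_algebra.
From mathcomp Require Import all_classical all_reals all_analysis.

Set Implicit Arguments.
Unset Strict Implicit.
Unset Printing Implicit Defensive.

Import Order.TTheory GRing.Theory Num.Theory.
Import numFieldNormedType.Exports.

Local Open Scope classical_set_scope.
Local Open Scope ring_scope.

Section Euclidean.
Context {R : realType} {d : nat}.
Implicit Types (x y : 'cV[R]_d) (A B : 'M[R]_d).

Definition dotv x y : R := (x^T *m y) 0 0.

(* The library norm on matrices is the sup norm. It is only used here through
   the topology it induces, which is the Euclidean one. *)
Definition enorm x : R := Num.sqrt (dotv x x).

Definition qform A x : R := dotv x (A *m x).

Definition mxnorm A x : R := Num.sqrt (qform A x).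

(* Positive semidefiniteness includes symmetry. *)
Definition loewner_le A B : Prop :=
  (B - A)^T = B - A /\ forall x, 0 <= qform (B - A) x.

End Euclidean.

Section Calculus.
Context {R : realType} {d : nat}.
Implicit Types (f : 'cV[R]_d -> R) (x u : 'cV[R]_d) (U : set 'cV[R]_d).

Definition evec (i : 'I_d) : 'cV[R]_d := delta_mx i 0.

Definition pderiv (i : 'I_d) f : 'cV[R]_d -> R := fun x => 'D_(evec i) f x.

Definition grad f x : 'cV[R]_d := \col_i pderiv i f x.

Definition hess f x : 'M[R]_d := \matrix_(i, j) pderiv i (pderiv j f) x.

Definition third_form f x u : R :=
  \sum_i \sum_j \sum_k
    pderiv i (pderiv j (pderiv k f)) x * u i 0 * u j 0 * u k 0.

(* f is C^k on the open set U: all its partial derivatives of order at most k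
   exist and are continuous on U. *)
Fixpoint Ck (k : nat) U f : Prop :=
  (forall x, U x -> {for x, continuous f}) /\
  (if k is k'.+1 then
     forall i, (forall x, U x -> derivable f x (evec i)) /\ Ck k' U (pderiv i f)
   else True).

End Calculus.

(* Functions on int K are represented by total functions whose values outside
   int K are irrelevant. *)
Section SelfConcordance.
Context {R : realType} {d : nat}.
Implicit Types (K : set 'cV[R]_d) (f : 'cV[R]_d -> R).

Definition self_concordant K (M : R) f : Prop :=
  [/\ 0 <= M,
      convex_function (interior K) f,
      Ck 3 (interior K) f,
      (forall (x_ : nat -> 'cV[R]_d) (x : 'cV[R]_d),
         (forall n, interior K (x_ n)) -> (closure K `\` interior K) x ->
         x_ n @[n --> \oo] --> x -> f (x_ n) @[n --> \oo] --> +oo) &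
      (forall x u, interior K x ->
         `|third_form f x u| <= 2 * M * mxnorm (hess f x) u ^+ 3)].

(* invmx is a genuine inverse here: when K is bounded and d > 0,
   self-concordance already forces the Hessian to be nonsingular on int K. *)
Definition sc_barrier K (M nu : R) f : Prop :=
  self_concordant K M f /\
  forall w, interior K w -> qform (invmx (hess f w)) (grad f w) <= nu.

End SelfConcordance.

Section OnlineLearning.
Context {R : realType} {d : nat}.

(* g is a subgradient at w of the loss l : K -> R. Membership of w in K is
   deliberately not part of the definition. *)
Definition subgradient (K : set 'cV[R]_d) (l : 'cV[R]_d -> R)
    (w g : 'cV[R]_d) : Prop :=
  forall v, K v -> l w + dotv g (v - w) <= l v.

End OnlineLearning.

(* Computations returning a value together with the number of elementary
   operations they use. *)
Section Cost.

Definition costed (A : Type) : Type := (A * nat)%type.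

Definition ret {A : Type} (a : A) : costed A := (a, 0%N).

Definition bind {A B : Type} (c : costed A) (f : A -> costed B) : costed B :=
  ((f c.1).1, (c.2 + (f c.1).2)%N).

Record oracle (A B : Type) := Oracle { answer : A -> B; call_cost : nat }.

Definition call {A B : Type} (O : oracle A B) (a : A) : costed B :=
  (answer O a, call_cost O).

End Cost.

Local Notation "'let!' x ':=' c 'in' k" := (bind c (fun x => k))
  (at level 200, x name, c at level 100, k at level 200).

Section Oracles.
Context {R : realType} {d : nat}.

Definition grad_oracle := oracle 'cV[R]_d 'cV[R]_d.

(* The answer is the pair (H, H^-1). *)
Definition hess_oracle := oracle 'cV[R]_d ('M[R]_d * 'M[R]_d).

Definition is_grad_oracle (K : set 'cV[R]_d) (eps : R) (F : 'cV[R]_d -> R)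
    (O : grad_oracle) : Prop :=
  forall w, interior K w ->
    mxnorm (invmx (hess F w)) (answer O w - grad F w) <= eps.

Definition is_hess_oracle (K : set 'cV[R]_d) (alpha : R) (F : 'cV[R]_d -> R)
    (O : hess_oracle) : Prop :=
  forall w, interior K w ->
    let H := (answer O w).1 in
    let Hinv := (answer O w).2 in
    [/\ H \in unitmx, Hinv = invmx H,
        loewner_le ((1 - alpha) *: hess F w) H /\
        loewner_le H ((1 + alpha) *: hess F w) &
        loewner_le ((1 - alpha) *: invmx (hess F w)) Hinv /\
        loewner_le Hinv ((1 + alpha) *: invmx (hess F w))].

End Oracles.

Arguments grad_oracle : clear implicits.
Arguments hess_oracle : clear implicits.

Section BARONS.
Context {R : realType} {d : nat}.

Definition add_op (x y : 'cV[R]_d) : costed 'cV[R]_d := (x + y, d).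

Definition sub_op (x y : 'cV[R]_d) : costed 'cV[R]_d := (x - y, d).

Definition scale_op (a : R) (x : 'cV[R]_d) : costed 'cV[R]_d := (a *: x, d).

(* d ^ 2 multiplications and at most d ^ 2 additions *)
Definition mulmx_op (A : 'M[R]_d) (x : 'cV[R]_d) : costed 'cV[R]_d :=
  (A *m x, (2 * d ^ 2)%N).

(* a matrix-vector product, an inner product and a square root *)
Definition mxnorm_op (A : 'M[R]_d) (x : 'cV[R]_d) : costed R :=
  (mxnorm A x, (2 * d ^ 2 + 2 * d + 1)%N).

Definition le_op (a b : R) : costed bool := (a <= b, 1%N).

Record state := State {
  st_w : 'cV[R]_d;
  st_u : 'cV[R]_d;
  st_H : 'M[R]_d;
  st_Hinv : 'M[R]_d;
  st_s : 'cV[R]_d }.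

Variables (Ograd : grad_oracle R d) (Ohess : hess_oracle R d).
Variables (M eta : R) (mN : nat) (wstar : 'cV[R]_d).

Definition newton_step (Hinv : 'M[R]_d) (s w : 'cV[R]_d) : costed 'cV[R]_d :=
  let! ghat := call Ograd w in
  let! gtilde := add_op ghat s in
  let! p := mulmx_op Hinv gtilde in
  sub_op w p.

Fixpoint newton (n : nat) (Hinv : 'M[R]_d) (s w : 'cV[R]_d) :
    costed 'cV[R]_d :=
  if n is n'.+1 then
    let! w' := newton_step Hinv s w in newton n' Hinv s w'
  else ret w.

Definition barons_init : costed state :=
  let! HH := call Ohess wstar in
  ret (State wstar wstar HH.1 HH.2 0).

Definition barons_round (st : state) (g : 'cV[R]_d) : costed state :=
  let! eg := scale_op eta g in
  let! s := add_op (st_s st) eg in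
  let! w := newton mN.-1 (st_Hinv st) s (st_w st) in
  let! v := sub_op w (st_u st) in
  let! r := mxnorm_op (st_H st) v in
  let! keep := le_op r (1 / (41 * M)) in
  if keep then ret (State w (st_u st) (st_H st) (st_Hinv st) s)
  else
    let! HH := call Ohess w in
    ret (State w w HH.1 HH.2 s).

(* State after n rounds with observed subgradients g 0, ..., g (n - 1). Time is
   counted from 0: g t is the subgradient observed at the t-th iterate, and
   t = 0 is the first round. *)
Fixpoint barons (g : nat -> 'cV[R]_d) (n : nat) : costed state :=
  if n is n'.+1 then
    let! st := barons g n' in barons_round st (g n')
  else barons_init.

Definition barons_iterate (g : nat -> 'cV[R]_d) (t : nat) : 'cV[R]_d :=
  st_w (barons g t).1.

Definition barons_cost (g : nat -> 'cV[R]_d) (T : nat) : nat :=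
  (barons g T).2.

End BARONS.

(* Main.v *)
(* A Newton iterate is never an exact minimiser of Phi + <s_t, .>, but the
   residual e_t = grad Phi(w_t) + s_(t-1) is of order eps in the dual local norm.
   Indeed, on a Dikin ball of radius 1/(20 M) the Hessian of Phi differs from the
   frozen matrix H_t by at most H_t / 4, so each inexact step multiplies the
   residual by at most 1/4 up to an additive O(eps), and log(1/(eps M)) steps
   suffice.

   The bound nu/R^2 I <= Hess Phi gives every eta g_t a dual local norm of at most
   a = eta R G / sqrt nu, so that |w_(t+1) - w_t| = O(a) in the norm of H_t. This
   counts the Hessian updates, because each requires a total displacement 1/(41 M).

   For the regret, write eta g_t = (e_(t+1) - grad Phi(w_(t+1))) - (e_t - grad Phi(w_t))
   and telescope the Bregman divergences D(v, w_t). What remains is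
   Phi(v) - Phi(wstar), a sum of terms O(a^2), and the boundary term
   <e_T, w_T - v> - D(v, w_T), which is O(eps^2) since D grows at least linearly.
   For v = wstar + (1 - 1/T)(w - wstar), the barrier property yields
   Phi(v) - Phi(wstar) <= nu ln T + nu/2.

   Finally nu M^2 >= 1 on a bounded body, so the hypothesis on eps makes T large. *)

Require Import Defs.
From HB Require Import structures.
From mathcomp Require Import all_boot all_order all_algebra.
From mathcomp Require Import all_classical all_reals all_analysis.
From mathcomp Require Import ring lra zify.

Set Implicit Arguments.
Unset Strict Implicit.
Unset Printing Implicit Defensive.

Import Order.TTheory GRing.Theory Num.Theory.
Import numFieldNormedType.Exports.

Local Open Scope classical_set_scope.
Local Open Scope ring_scope.

(** * Functions of one real variable *)

Section OneVariable.
Context {R : realType}.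
Implicit Types (f df phi : R -> R) (a b t : R).

(** Self-concordance bounds the third derivative only at [(u, u, u)], whereas comparing Hessians
    needs its values at [(p, h, h)]. Polarizing the symmetric trilinear form loses a factor 4/3,
    which is affordable because only the fixed contraction ratio 1/4 has to come out. All calculus
    runs along lines, so regularity stated through partial derivatives must first be upgraded to
    derivatives in every direction and to symmetric mixed partials. Errors do not accumulate over
    the rounds: [s_t] is maintained exactly, so every round brings the residual back to O(eps), and
    in the regret identity the residual terms telescope until only the last one survives. The gap is
    the room for the Newton path of one round, and it dictates how small [a] and [eps] must be
    compared with 1/M. *)

Lemma is_derive_mvt f df a b : a <= b ->
  (forall t, a <= t <= b -> is_derive t 1 f (df t)) ->
  exists2 c, a <= c <= b & f b - f a = df c * (b - a).
Proof.
move=> ab H.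
have fd x : x \in `]a, b[ -> is_derive x 1 f (df x).
  by rewrite in_itv /= => /andP[ax xb]; apply: H; rewrite !ltW.
have fc : {within `[a, b], continuous f}.
  apply: derivable_within_continuous => x; rewrite in_itv /= => xab.
  by have := H x xab => ?; exact: ex_derive.
by have [c cab E] := MVT_segment ab fd fc; exists c => //; rewrite in_itv in cab.
Qed.

Lemma is_derive_nincr f df a b : a <= b ->
  (forall t, a <= t <= b -> is_derive t 1 f (df t)) ->
  (forall t, a <= t <= b -> df t <= 0) -> f b <= f a.
Proof.
move=> ab fd df0; have [c cab E] := is_derive_mvt ab fd.
by rewrite -subr_le0 E mulr_le0_ge0 ?df0// subr_ge0.
Qed.

Lemma is_derive_ndecr f df a b : a <= b ->
  (forall t, a <= t <= b -> is_derive t 1 f (df t)) ->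
  (forall t, a <= t <= b -> 0 <= df t) -> f a <= f b.
Proof.
move=> ab fd df0; have [c cab E] := is_derive_mvt ab fd.
by rewrite -subr_ge0 E mulr_ge0 ?df0// subr_ge0.
Qed.

(** [expR (- lam * s) * f s] is nonincreasing and [expR (lam * s) * f s] is nondecreasing. *)
Lemma gronwall f df (lam t : R) : 0 <= t ->
  (forall s, 0 <= s <= t -> is_derive s 1 f (df s)) ->
  (forall s, 0 <= s <= t -> `|df s| <= lam * f s) ->
  f t <= expR (lam * t) * f 0 /\ f 0 <= expR (lam * t) * f t.
Proof.
move=> t0 fd dfle.
have eD (k s : R) : is_derive s 1 (fun s => expR (k * s)) (expR (k * s) * k).
  have -> : (fun s => expR (k * s)) = expR \o (fun s : R => k * s) by [].
  apply: is_derive1_comp; apply: is_derive_eq; rewrite /GRing.scale/=; ring.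
have H k : (forall s, 0 <= s <= t ->
    is_derive s 1 (fun s => expR (k * s) * f s) (expR (k * s) * (k * f s + df s))).
  move=> s st; have := fd s st => fds; have := eD k s => eDs.
  apply: is_derive_eq; rewrite /GRing.scale/=; ring.
split.
- have := @is_derive_nincr _ _ 0 t t0 (H (- lam)).
  rewrite mulr0 expR0 mul1r mulNr expRN => /(_ _)/wrap[].
    move=> s st; rewrite pmulr_rle0 ?expR_gt0// mulNr addrC subr_le0.
    exact: le_trans (ler_norm _) (dfle s st).
  by rewrite mulrC ler_pdivrMr ?expR_gt0// mulrC.
- have := @is_derive_ndecr _ _ 0 t t0 (H lam).
  rewrite mulr0 expR0 mul1r; apply => s st.
  rewrite pmulr_rge0 ?expR_gt0// -[df s]opprK subr_ge0.
  apply: le_trans (dfle s st); rewrite -normrN; exact: ler_norm.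
Qed.

(** Where [phi > 0], the derivative of [phi^(-1/2)] is at least [- M]; integrating and multiplying
    by both square roots gives the bound. The product form still makes sense when [phi] vanishes:
    [phi 0 = 0] forces [phi t = 0]. To allow zeros, the argument is run for [phi + d] and [d] is
    sent to 0. *)
Lemma riccati phi dphi (M t : R) : 0 <= M -> 0 <= t ->
  (forall s, 0 <= s <= t -> is_derive s 1 phi (dphi s)) ->
  (forall s, 0 <= s <= t -> 0 <= phi s) ->
  (forall s, 0 <= s <= t -> `|dphi s| <= 2 * M * Num.sqrt (phi s) ^+ 3) ->
  Num.sqrt (phi t) - Num.sqrt (phi 0)
    <= M * t * Num.sqrt (phi 0) * Num.sqrt (phi t).
Proof.
move=> M0 t0 fd phi0 dle.
have key d : 0 < d -> Num.sqrt (phi t) - Num.sqrt (phi 0 + d)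
    <= M * t * Num.sqrt (phi 0 + d) * Num.sqrt (phi t + d).
  move=> d0; pose psi s := Num.sqrt (phi s + d).
  have psi_gt0 s : 0 <= s <= t -> 0 < psi s.
    by move=> st; rewrite sqrtr_gt0 ltr_wpDl ?phi0.
  have psiD s : 0 <= s <= t -> is_derive s 1 (fun s => (psi s)^-1 + M * s)
     (- (psi s) ^- 2 * (dphi s / (2 * psi s)) + M).
    move=> st; have := fd s st => fds.
    have pd : 0 < phi s + d by rewrite ltr_wpDl ?phi0.
    have p1 : is_derive s 1 (fun s => phi s + d) (dphi s).
      by apply: is_derive_eq; rewrite addr0.
    have p2 : is_derive s 1 psi ((2 * psi s)^-1 * dphi s).
      have := is_derive1_sqrt pd => q.
      by have -> : psi = Num.sqrt \o (fun s => phi s + d) by []; apply: is_derive1_comp.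
    have pn0 : psi s != 0 by rewrite gt_eqF ?psi_gt0.
    have p3 : is_derive s 1 (fun s => (psi s)^-1) (- (psi s) ^- 2 * (dphi s / (2 * psi s))).
      have := is_deriveV pn0 p2 => q.
      by apply: is_derive_eq; rewrite /GRing.scale/=; congr (_ * _); rewrite mulrC.
    by apply: is_derive_eq; rewrite /GRing.scale/=; ring.
  have t00 : 0 <= (0:R) <= t by rewrite lexx.
  have ttt : 0 <= t <= t by rewrite lexx andbT.
  have := is_derive_ndecr t0 psiD => /(_ _)/wrap[].
    move=> s st.
    have := psi_gt0 s st => ps.
    rewrite mulNr addrC subr_ge0.
    rewrite ler_pdivrMl ?exprn_gt0// ler_pdivrMr ?mulr_gt0//.
    apply: le_trans (ler_norm _) _; apply: le_trans (dle s st) _.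
    have -> : psi s ^+ 2 * M * (2 * psi s) = 2 * M * psi s ^+ 3 by ring.
    apply: ler_wpM2l; first by rewrite mulr_ge0.
    rewrite lerXn2r ?nnegrE ?sqrtr_ge0//.
    by rewrite ler_wsqrtr// lerDl ltW.
  rewrite mulr0 addr0 => h.
  have a0 := psi_gt0 _ t00; have b0 := psi_gt0 _ ttt.
  rewrite -/(psi 0) -/(psi t).
  have : psi t - psi 0 <= M * t * psi 0 * psi t.
    have := h; rewrite -subr_ge0 => h'.
    have := mulr_ge0 (mulr_ge0 (ltW a0) (ltW b0)) h'.
    have -> : psi 0 * psi t * ((psi t)^-1 + M * t - (psi 0)^-1) =
      psi 0 * (psi t / psi t) + M * t * psi 0 * psi t - psi t * (psi 0 / psi 0) by ring.
    rewrite !divff ?gt_eqF//; lra.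
  apply: le_trans; rewrite lerD2r ler_wsqrtr// lerDl ltW//.
set a := Num.sqrt (phi 0); set b := Num.sqrt (phi t).
have sqD (x d : R) : 0 <= x -> 0 <= d -> Num.sqrt (x + d ^+ 2) <= Num.sqrt x + d.
  move=> x0 d0; rewrite -(@ler_pXn2r _ 2)// ?nnegrE ?addr_ge0 ?sqrtr_ge0//.
  rewrite sqr_sqrtr ?addr_ge0 ?sqr_ge0// sqrrD sqr_sqrtr// addrAC.
  by rewrite lerDl mulrn_wge0// mulr_ge0 ?sqrtr_ge0.
have a0 : 0 <= a by exact: sqrtr_ge0.
have b0 : 0 <= b by exact: sqrtr_ge0.
(* The shift used is [d ^+ 2], so that each square root moves by at most [d]. With [d <= 1], both
   sides together err by at most [k * d]. *)
apply/ler_addgt0Pl => e e0.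
have Mt0 : 0 <= M * t by rewrite mulr_ge0.
pose k := 1 + M * t * (a + b + 1).
have k0 : 0 < k by rewrite ltr_pwDl// mulr_ge0// !addr_ge0.
pose d := Num.min 1 (e / k).
have d0 : 0 < d by rewrite lt_min ltr01 divr_gt0.
have d1 : d <= 1 by rewrite ge_min lexx.
have dk : d * k <= e by rewrite -ler_pdivlMr// ge_min lexx orbT.
have := key (d ^+ 2) (exprn_gt0 _ d0); rewrite -/b => kd.
have pa : Num.sqrt (phi 0 + d ^+ 2) <= a + d.
  by apply: sqD (ltW d0); rewrite phi0 ?lexx.
have pb : Num.sqrt (phi t + d ^+ 2) <= b + d.
  by apply: sqD (ltW d0); rewrite phi0 ?lexx ?t0.
have pab : M * t * Num.sqrt (phi 0 + d ^+ 2) * Num.sqrt (phi t + d ^+ 2)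
    <= M * t * ((a + d) * (b + d)).
  by rewrite -mulrA ler_wpM2l// ler_pM ?sqrtr_ge0.
have dd : M * t * ((a + d) * (b + d)) <= M * t * a * b + M * t * (a + b + 1) * d.
  rewrite -subr_ge0.
  have -> : M * t * a * b + M * t * (a + b + 1) * d - M * t * ((a + d) * (b + d)) =
    M * t * (d * (1 - d)) by ring.
  by rewrite mulr_ge0// mulr_ge0 ?subr_ge0// ltW.
have : d * k = d + M * t * (a + b + 1) * d by rewrite /k; ring.
lra.
Qed.

End OneVariable.

(** * Partial derivatives *)

Section Lines.
Context {R : realType} {V : normedModType R}.
Implicit Types (f : V -> R) (x v : V).

Lemma is_derive_line f x v (t df : R) :
  is_derive (x + t *: v) v f df ->
  is_derive t 1 (fun s => f (x + s *: v)) df.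
Proof.
have E : (fun h : R => h^-1 *: (((fun s => f (x + s *: v)) \o shift t) (h *: 1)
      - f (x + t *: v))) =
    (fun h => h^-1 *: ((f \o shift (x + t *: v)) (h *: v) - f (x + t *: v))).
  apply/funext => h /=; congr (_ *: (f _ - _)).
  by rewrite [h *: 1]mulr1 scalerDl addrCA addrA.
move=> [fd <-]; split; last by rewrite /derive E.
by rewrite /derivable E.
Qed.

(** The chain rule with [s |-> s * c] on the line covers [c = 0], where rescaling the difference
    quotient would fail. *)
Lemma is_derive_scale f x v (c df : R) :
  is_derive x v f df -> is_derive x (c *: v) f (c * df).
Proof.
move=> fd.
have fd0 : is_derive (x + (0 * c) *: v) v f df by rewrite mul0r scale0r addr0.
have d1 : is_derive (0 * c : R) 1 (fun s => f (x + s *: v)) df.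
  exact: is_derive_line.
have d2 : is_derive (0 : R) 1 ( *%R^~ c) c.
  by apply: is_derive_eq; rewrite /GRing.scale/=; ring.
have d3 : is_derive (0 : R) 1 ((fun s => f (x + s *: v)) \o ( *%R^~ c)) (df * c).
  exact: is_derive1_comp.
have E : (fun h : R => h^-1 *: ((((fun s => f (x + s *: v)) \o ( *%R^~ c)) \o shift 0) (h *: 1)
      - ((fun s => f (x + s *: v)) \o ( *%R^~ c)) 0)) =
    (fun h => h^-1 *: ((f \o shift x) (h *: (c *: v)) - f x)).
  apply/funext => h /=; congr (_ *: (f _ - f _)).
    by rewrite [h *: 1]mulr1 addr0 scalerA addrC.
  by rewrite mul0r scale0r addr0.
case: d3; rewrite /derivable /derive E => d3 d3'; rewrite mulrC.
by split.
Qed.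

Lemma mvt_line f x v :
  (forall s : R, 0 <= s <= 1 -> derivable f (x + s *: v) v) ->
  exists2 s : R, 0 <= s <= 1 & f (x + v) - f x = 'D_v f (x + s *: v).
Proof.
move=> fd; have [|c c01] := @is_derive_mvt R (fun s => f (x + s *: v))
  (fun s => 'D_v f (x + s *: v)) 0 1 ler01.
  by move=> s s01; apply: is_derive_line; apply/derivableP/fd.
by rewrite scale1r scale0r addr0 subr0 mulr1 => E; exists c.
Qed.

Lemma continuous_ball f x (U : set V) (e : R) : open U -> U x -> {for x, continuous f} -> 0 < e ->
  exists2 r : R, 0 < r & forall y, `|y - x| < r -> U y /\ `|f y - f x| < e.
Proof.
move=> oU Ux fc e0.
have n1 : nbhs x [set y | `|f x - f y| < e].
  by move/cvgrPdist_lt : fc => /(_ _ e0).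
have n2 : nbhs x U by exact: open_nbhs_nbhs.
have : nbhs x (U `&` [set y | `|f x - f y| < e]) by exact: filterI.
rewrite -nbhs_ballE => -[r /= r0 H]; exists r => // y yr.
have [|Uy ye] := H y; first by rewrite -ball_normE /= distrC.
by split; rewrite // distrC.
Qed.

End Lines.

Section PartialDerivatives.
Context {R : realType} {d : nat}.
Implicit Types (f : 'cV[R]_d -> R) (x u v w : 'cV[R]_d) (U : set 'cV[R]_d).

Lemma Ck_continuous k U f x : Ck k U f -> U x -> {for x, continuous f}.
Proof. by case: k => [|k] [+ _]; exact. Qed.

Lemma Ck_derivable k U f x i : Ck k.+1 U f -> U x -> derivable f x (evec i).
Proof. by move=> [_ /(_ i) [+ _]]; exact. Qed.

Lemma Ck_pderiv k U f i : Ck k.+1 U f -> Ck k U (pderiv i f).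
Proof. by move=> [_ /(_ i) []]. Qed.

Lemma CkW k U f : Ck k.+1 U f -> Ck k U f.
Proof.
elim: k f => [|k IH] f [fc fd]; split=> // i.
by split; [exact: (fd i).1|apply: IH; exact: (fd i).2].
Qed.

Lemma normr_evec (i : 'I_d) : `|evec i : 'cV[R]_d| <= 1.
Proof.
rewrite [leLHS]/Num.Def.normr/= mx_normrE; apply: bigmax_le => //= -[j k] _ /=.
by rewrite mxE; case: (_ && _); rewrite ?normr1 ?normr0.
Qed.

Lemma derive_scale_evec f y (c : R) i : derivable f y (evec i) ->
  derivable f y (c *: evec i) /\ 'D_(c *: evec i) f y = c * pderiv i f y.
Proof.
move=> /derivableP fd.
by have [? E] := is_derive_scale c fd; split.
Qed.

(** The quotient along [v + c *: evec i] is the quotient along [v] plus an increment in coordinate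
    [i] alone, taken from the moving base point [h *: v + x]. By the mean value theorem this
    increment is [c] times a partial derivative at a point tending to [x], and continuity of that
    partial concludes. *)
Lemma is_derive_add_evec U f x v (a c : R) i :
  open U -> U x -> Ck 1 U f -> is_derive x v f a ->
  is_derive x (v + c *: evec i) f (a + c * pderiv i f x).
Proof.
move=> oU Ux fC [fd fa].
have fD : (fun h : R => h^-1 *: ((f \o shift x) (h *: v) - f x)) @ 0^' --> a.
  by rewrite -fa; exact: fd.
suff H : (fun h : R => h^-1 *: ((f \o shift x) (h *: (v + c *: evec i)) - f x))
     @ 0^' --> a + c * pderiv i f x.
  split; [by apply/cvg_ex; eexists; exact: H|exact: (cvg_lim _ H)].
have -> : (fun h : R => h^-1 *: ((f \o shift x) (h *: (v + c *: evec i)) - f x)) =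
   (fun h : R => h^-1 *: ((f \o shift x) (h *: v) - f x)
   + h^-1 * (f (h *: v + x + (h * c) *: evec i) - f (h *: v + x))).
  apply/funext => h; rewrite -[h^-1 * _]/(h^-1 *: (_ : R^o)) -scalerDr.
  congr (_ *: _); rewrite [RHS]addrC addrA subrK /=.
  by rewrite scalerDr scalerA addrAC.
apply: cvgD => //; apply/cvgrPdist_lt => e e0.
have c1 : 0 < `|c| + 1 by rewrite ltr_wpDl.
have [r r0 rP] := continuous_ball oU Ux
   (Ck_continuous (Ck_pderiv i fC) Ux) (divr_gt0 e0 c1).
pose B := `|v| + `|c| + 1.
have B0 : 0 < B by rewrite ltr_wpDl// addr_ge0.
have : \forall h \near 0^', `|h : R| < r / B.
  apply/dnbhs0_lt; by rewrite divr_gt0.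
have : \forall h \near 0^', (h : R) != 0 by exact: nbhs_dnbhs_neq.
apply: filterS2 => h h0 hr.
have near_x s : 0 <= s <= 1 -> `|h *: v + x + s *: ((h * c) *: evec i) - x| < r.
  move=> /andP[s0 s1].
  have -> : h *: v + x + s *: ((h * c) *: evec i) - x
     = h *: (v + (s * c) *: evec i).
    by rewrite addrAC addrK scalerDr !scalerA (mulrCA s).
  rewrite normrZ; apply: le_lt_trans (_ : `|h| * B < r); last by rewrite -ltr_pdivlMr.
  rewrite ler_wpM2l// (le_trans (ler_normD _ _))// /B -addrA lerD2l.
  rewrite normrZ normrM (ger0_norm s0).
  have := normr_evec i; have := normr_ge0 (evec i : 'cV[R]_d); have := normr_ge0 c.
  move=> cc ee e1; apply: le_trans (_ : `|c| <= _); last by rewrite lerDl.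
  by rewrite mulrAC ler_piMl// mulr_ile1.
have [|s s01 ->] := @mvt_line _ _ f (h *: v + x) ((h * c) *: evec i).
  move=> s s01; apply: (derive_scale_evec _ _).1; apply: Ck_derivable fC _.
  exact: (rP _ (near_x s s01)).1.
have [Uy ye] := rP _ (near_x s s01).
rewrite (derive_scale_evec _ (Ck_derivable (i := i) fC Uy)).2.
rewrite -mulrA mulKf// -mulrBr normrM distrC.
rewrite ltr_pdivlMr// in ye; by apply: le_lt_trans ye; rewrite mulrC ler_wpM2l// lerDl.
Qed.

Lemma is_derive_grad U f x v : open U -> U x -> Ck 1 U f ->
  is_derive x v f (\sum_i v i 0 * pderiv i f x).
Proof.
move=> oU Ux fC.
have {1}-> : v = \sum_i v i 0 *: evec i.
  rewrite {1}[v]matrix_sum_delta; apply: eq_bigr => i _.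
  by rewrite big_ord1.
elim: (index_enum 'I_d) => [|i r IH]; first by rewrite !big_nil; exact: is_derive0.
rewrite !big_cons addrC [X in is_derive _ _ _ X]addrC.
exact: is_derive_add_evec oU Ux fC IH.
Qed.

(** Two mean value theorems, along [evec i] and then along [evec j]. The left-hand side is symmetric
    in [i] and [j], the right-hand side is not: this is the source of Schwarz's theorem. *)
Lemma second_difference U f x i j (r s : R) : Ck 2 U f ->
  (forall y, `|y - x| < r -> U y) -> 0 < s -> 2 * s < r ->
  exists2 y, `|y - x| < r &
    f (x + s *: evec j + s *: evec i) - f (x + s *: evec i)
      - (f (x + s *: evec j) - f x) = s ^+ 2 * pderiv j (pderiv i f) y.
Proof.
move=> fC xrU s0 sr.
have nr a b : 0 <= a <= 1 -> 0 <= b <= 1 ->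
    `|x + a *: (s *: evec i) + b *: (s *: evec j) - x| < r.
  move=> /andP[a0 a1] /andP[b0 b1].
  rewrite -[x + _ + _]addrA [x + _]addrC addrK; apply: le_lt_trans sr.
  apply: le_trans (ler_normD _ _) _.
  rewrite mulr_natl mulr2n; apply: lerD; rewrite !normrZ !ger0_norm ?(ltW s0)//.
    by rewrite mulrCA ler_piMr ?(ltW s0)// mulr_ile1 ?normr_evec.
  by rewrite mulrCA ler_piMr ?(ltW s0)// mulr_ile1 ?normr_evec.
have i0 : 0 <= (0 : R) <= 1 by rewrite lexx ler01.
have i1 : 0 <= (1 : R) <= 1 by rewrite lexx ler01.
have nr0 a : 0 <= a <= 1 -> `|x + a *: (s *: evec i) - x| < r.
  by move=> a01; have := nr a 0 a01 i0; rewrite scale0r addr0.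
have fC1 := CkW fC.
have [|c c01] := @is_derive_mvt R
   (fun a => f (x + s *: evec j + a *: (s *: evec i)) - f (x + a *: (s *: evec i)))
   (fun a => s * pderiv i f (x + s *: evec j + a *: (s *: evec i))
             - s * pderiv i f (x + a *: (s *: evec i))) 0 1 ler01.
  move=> a a01.
  have U1 : U (x + s *: evec j + a *: (s *: evec i)).
    by rewrite addrAC; apply: xrU; have := nr a 1 a01 i1; rewrite scale1r.
  have U0 : U (x + a *: (s *: evec i)) by apply: xrU; exact: nr0.
  have d1 := is_derive_scale s (derivableP (Ck_derivable (i := i) fC U1)).
  have d0 := is_derive_scale s (derivableP (Ck_derivable (i := i) fC U0)).
  have := is_derive_line d1 => d1'; have := is_derive_line d0 => d0'.
  exact: is_deriveB.
rewrite !scale1r !scale0r !addr0 subr0 mulr1 => E.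
have [|b b01 E2] := @mvt_line _ _ (pderiv i f) (x + c *: (s *: evec i)) (s *: evec j).
  move=> b b01; apply: (derive_scale_evec _ _).1.
  by apply: Ck_derivable (Ck_pderiv i fC) _; apply: xrU; exact: nr.
exists (x + c *: (s *: evec i) + b *: (s *: evec j)); first exact: nr.
rewrite E -mulrBr [x + s *: _ + _]addrAC E2 expr2 -mulrA; congr (_ * _).
rewrite (derive_scale_evec _ _).2//.
by apply: Ck_derivable (Ck_pderiv i fC) _; apply: xrU; exact: nr.
Qed.

(** Read in both orders, one second difference shows that the two mixed partials take equal values
    at two points [y] and [z] close to [x]; continuity at [x] transfers this to [x]. *)
Lemma pderivC U f x i j : open U -> U x -> Ck 2 U f ->
  pderiv i (pderiv j f) x = pderiv j (pderiv i f) x.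
Proof.
move=> oU Ux fC; apply/eqP; rewrite -subr_eq0 -normr_le0.
apply/ler_addgt0Pl => e e0; rewrite addr0.
have e20 : 0 < e / 2 by rewrite divr_gt0.
have ccont k l := Ck_continuous (Ck_pderiv k (Ck_pderiv l fC)) Ux.
have [r1 r10 P1] := continuous_ball oU Ux (ccont i j) e20.
have [r2 r20 P2] := continuous_ball oU Ux (ccont j i) e20.
pose r := Num.min r1 r2; have r0 : 0 < r by rewrite lt_min r10.
have rU y : `|y - x| < r -> U y by rewrite lt_min => /andP[/P1[]].
have s0 : 0 < r / 4 by rewrite divr_gt0.
have sr : 2 * (r / 4) < r by move: r0; clear; lra.
have [y yr Ey] := second_difference i j fC rU s0 sr.
have [z zr Ez] := second_difference j i fC rU s0 sr.
have : pderiv j (pderiv i f) y = pderiv i (pderiv j f) z.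
  have /mulfI : (r / 4) ^+ 2 != 0 by rewrite gt_eqF// exprn_gt0.
  apply; rewrite -Ey -Ez [x + _ *: evec i + _]addrAC.
  by move: (f _) (f _) (f _) (f _) => *; ring.
move=> yz.
have [_ h1] : U y /\ `|pderiv j (pderiv i f) y - pderiv j (pderiv i f) x| < e / 2.
  by apply: P2; apply: lt_le_trans yr _; rewrite ge_min lexx orbT.
have [_ h2] : U z /\ `|pderiv i (pderiv j f) z - pderiv i (pderiv j f) x| < e / 2.
  by apply: P1; apply: lt_le_trans zr _; rewrite ge_min lexx.
move: h1 h2; rewrite yz.
move: (pderiv i _ z) (pderiv i _ x) (pderiv j _ x) => A p q h1 h2.
have -> : p - q = (A - q) - (A - p) by ring.
apply: le_trans (ler_normB _ _) _; rewrite [e]splitr; apply/ltW; exact: ltrD.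
Qed.

End PartialDerivatives.

(** * Quadratic and cubic forms *)

(* Unlike [mxnorm], this copy never unfolds to a square root during unification. *)
HB.lock Definition lnorm {R : realType} {d : nat} (A : 'M[R]_d) (x : 'cV[R]_d) : R :=
  mxnorm A x.

Section Forms.
Context {R : realType} {d : nat}.
Implicit Types (x y u v w : 'cV[R]_d) (A E H : 'M[R]_d).

Lemma dotvE x y : dotv x y = \sum_i x i 0 * y i 0.
Proof. by rewrite /dotv mxE; apply: eq_bigr => i _; rewrite mxE. Qed.

Lemma dotvC x y : dotv x y = dotv y x.
Proof. by rewrite !dotvE; apply: eq_bigr => i _; rewrite mulrC. Qed.

Lemma dotvDl x y z : dotv (x + y) z = dotv x z + dotv y z.
Proof. by rewrite /dotv linearD mulmxDl mxE. Qed.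

Lemma dotvZl c x z : dotv (c *: x) z = c * dotv x z.
Proof. by rewrite /dotv linearZ -scalemxAl mxE. Qed.

Lemma dotvNl x z : dotv (- x) z = - dotv x z.
Proof. by rewrite -scaleN1r dotvZl mulN1r. Qed.

Lemma dotvBl x y z : dotv (x - y) z = dotv x z - dotv y z.
Proof. by rewrite dotvDl dotvNl. Qed.

Lemma dotvDr x y z : dotv z (x + y) = dotv z x + dotv z y.
Proof. by rewrite dotvC dotvDl !(dotvC z). Qed.

Lemma dotvZr c x z : dotv z (c *: x) = c * dotv z x.
Proof. by rewrite dotvC dotvZl (dotvC z). Qed.

Lemma dotvNr x z : dotv z (- x) = - dotv z x.
Proof. by rewrite dotvC dotvNl (dotvC z). Qed.

Lemma dotvBr x y z : dotv z (x - y) = dotv z x - dotv z y.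
Proof. by rewrite dotvDr dotvNr. Qed.

Lemma dotv_ge0 x : 0 <= dotv x x.
Proof. by rewrite dotvE sumr_ge0// => i _; rewrite -expr2 sqr_ge0. Qed.

Lemma dotv_eq0 x : dotv x x = 0 -> x = 0.
Proof.
move=> /eqP; rewrite dotvE psumr_eq0 => [|i _]; last by rewrite -expr2 sqr_ge0.
move=> /allP H; apply/matrixP => i j; rewrite ord1 mxE.
by have := H i; rewrite mem_index_enum mulf_eq0 orbb => /(_ isT)/eqP.
Qed.

Definition bform A x y := dotv x (A *m y).

Lemma lnorm_mxnorm A x : lnorm A x = mxnorm A x.
Proof. by rewrite lnorm.unlock. Qed.

Lemma lnormE A x : lnorm A x = Num.sqrt (qform A x).
Proof. exact: lnorm_mxnorm. Qed.

Lemma bformDl A x y z : bform A (x + y) z = bform A x z + bform A y z.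
Proof. exact: dotvDl. Qed.

Lemma bformZl A c x z : bform A (c *: x) z = c * bform A x z.
Proof. exact: dotvZl. Qed.

Lemma bformNl A x z : bform A (- x) z = - bform A x z.
Proof. exact: dotvNl. Qed.

Lemma bformDr A x y z : bform A z (x + y) = bform A z x + bform A z y.
Proof. by rewrite /bform mulmxDr dotvDr. Qed.

Lemma bformZr A c x z : bform A z (c *: x) = c * bform A z x.
Proof. by rewrite /bform -scalemxAr dotvZr. Qed.

Lemma bformC A x y : A^T = A -> bform A x y = bform A y x.
Proof.
move=> As; rewrite /bform /dotv.
rewrite -[in LHS](trmxK (x^T *m (A *m y))) mxE !trmx_mul trmxK As.
by rewrite mulmxA.
Qed.

Lemma bform_mx A B c x y : bform (A + c *: B) x y = bform A x y + c * bform B x y.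
Proof. by rewrite /bform mulmxDl dotvDr -scalemxAl dotvZr. Qed.

Lemma qform_mx A B c x : qform (A + c *: B) x = qform A x + c * qform B x.
Proof. exact: bform_mx. Qed.

Lemma qformB A B x : qform (A - B) x = qform A x - qform B x.
Proof. by rewrite -scaleN1r qform_mx mulN1r. Qed.

Lemma qform_scale A c x : qform (c *: A) x = c * qform A x.
Proof. by rewrite -[c *: A]add0r qform_mx /qform mul0mx dotvE big1 ?add0r// => i _; rewrite mxE mulr0. Qed.

Lemma qformZ A c x : qform A (c *: x) = c ^+ 2 * qform A x.
Proof. by rewrite -[qform _ _]/(bform _ _ _) bformZl bformZr mulrA. Qed.

Lemma qformD A x y : A^T = A ->
  qform A (x + y) = qform A x + 2 * bform A x y + qform A y.
Proof.
move=> As; rewrite -[qform _ _]/(bform _ _ _) bformDl !bformDr (bformC y x As).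
rewrite -[qform _ _]/(bform _ _ _) -[qform _ y]/(bform _ _ _); ring.
Qed.

Lemma qform1 x : qform 1%:M x = dotv x x.
Proof. by rewrite /qform mul1mx. Qed.

Lemma qformx0 A : qform A 0 = 0.
Proof. by rewrite -(scale0r (0 : 'cV[R]_d)) qformZ expr0n mul0r. Qed.

Lemma lnorm0 A : lnorm A 0 = 0.
Proof. by rewrite !lnormE qformx0 sqrtr0. Qed.

Lemma lnorm_ge0 A x : 0 <= lnorm A x.
Proof. by rewrite lnormE sqrtr_ge0. Qed.

Lemma lnormZ A c x : lnorm A (c *: x) = `|c| * lnorm A x.
Proof. by rewrite !lnormE qformZ sqrtrM ?sqr_ge0// sqrtr_sqr. Qed.

Lemma lnormN A x : lnorm A (- x) = lnorm A x.
Proof. by rewrite -scaleN1r lnormZ normrN1 mul1r. Qed.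

Lemma lnormBC A x y : lnorm A (x - y) = lnorm A (y - x).
Proof. by rewrite -opprB lnormN. Qed.

Lemma enormE x : enorm x = lnorm 1%:M x.
Proof. by rewrite lnormE qform1. Qed.

Definition posdef A := A^T = A /\ forall x, x != 0 -> 0 < qform A x.

Lemma posdef1 : posdef 1%:M.
Proof.
split=> [|x x0]; first exact: trmx1.
by rewrite qform1 lt_neqAle dotv_ge0 andbT eq_sym; apply: contra x0 => /eqP/dotv_eq0->.
Qed.

Lemma posdef_ge0 A x : posdef A -> 0 <= qform A x.
Proof.
move=> [_ A0]; have [->|/A0/ltW//] := eqVneq x 0.
by rewrite qformx0.
Qed.

Lemma sqr_lnorm A x : posdef A -> lnorm A x ^+ 2 = qform A x.
Proof. by move=> Ap; rewrite lnormE sqr_sqrtr// posdef_ge0. Qed.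

Lemma lnorm_gt0 A x : posdef A -> x != 0 -> 0 < lnorm A x.
Proof. by move=> [_ Ap] /Ap x0; rewrite lnormE sqrtr_gt0. Qed.

(* Polarization, after rescaling both arguments to unit norm. *)
Lemma bform_le E H k x y : E^T = E -> posdef H ->
  (forall v, `|qform E v| <= k * qform H v) ->
  `|bform E x y| <= k * (lnorm H x * lnorm H y).
Proof.
move=> Es Hp EH.
have [->|x0] := eqVneq x 0.
  by rewrite lnorm0 mul0r mulr0 -(scale0r (0 : 'cV[R]_d)) bformZl mul0r normr0.
have [->|y0] := eqVneq y 0.
  by rewrite lnorm0 !mulr0 -(scale0r (0 : 'cV[R]_d)) bformZr mul0r normr0.
have Hs := Hp.1.
have unit_case u v : lnorm H u = 1 -> lnorm H v = 1 -> `|bform E u v| <= k.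
  move=> u1 v1.
  have h1 := EH (u + v); have h2 := EH (u - v).
  have e1 : qform H u = 1 by rewrite -sqr_lnorm// u1 expr1n.
  have e2 : qform H v = 1 by rewrite -sqr_lnorm// v1 expr1n.
  have := h1; have := h2; rewrite -scaleN1r !qformD// !bformZr !qformZ e1 e2.
  by rewrite !ler_norml => /andP[a1 a2] /andP[b1 b2]; apply/andP; split; lra.
have Nx := lnorm_gt0 Hp x0; have Ny := lnorm_gt0 Hp y0.
have nu z : z != 0 -> lnorm H ((lnorm H z)^-1 *: z) = 1.
  move=> z0; have Nz := lnorm_gt0 Hp z0.
  by rewrite lnormZ gtr0_norm ?invr_gt0// mulVf// gt_eqF.
have := unit_case _ _ (nu x x0) (nu y y0).
rewrite bformZl bformZr mulrA normrM gtr0_norm ?mulr_gt0 ?invr_gt0//.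
by rewrite -invfM ler_pdivrMl ?mulr_gt0// mulrC.
Qed.

Lemma cauchy_schwarz A x y : posdef A -> `|bform A x y| <= lnorm A x * lnorm A y.
Proof.
move=> Ap; rewrite -[leRHS]mul1r; apply: bform_le => //; first exact: Ap.1.
by move=> v; rewrite mul1r ger0_norm// posdef_ge0.
Qed.

Lemma lnormD A x y : posdef A -> lnorm A (x + y) <= lnorm A x + lnorm A y.
Proof.
move=> Ap; rewrite -(@ler_pXn2r _ 2)// ?nnegrE ?addr_ge0 ?lnorm_ge0//.
rewrite sqr_lnorm// qformD; last exact: Ap.1.
rewrite -!sqr_lnorm// sqrrD lerD2r lerD2l -[(_ * _) *+ 2]mulr_natl ler_pM2l//.
exact: le_trans (ler_norm _) (cauchy_schwarz _ _ Ap).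
Qed.

Lemma lnorm_trans A z x y : posdef A ->
  lnorm A (x - y) <= lnorm A (x - z) + lnorm A (z - y).
Proof. by move=> Ap; rewrite -(subrK z x) -[x - z + z - y]addrA addrK lnormD. Qed.

Lemma lnorm_le A B c x : 0 <= c -> (forall v, qform A v <= c ^+ 2 * qform B v) ->
  lnorm A x <= c * lnorm B x.
Proof.
move=> c0 AB; rewrite !lnormE.
have -> : c * Num.sqrt (qform B x) = Num.sqrt (c ^+ 2 * qform B x).
  by rewrite sqrtrM ?sqr_ge0// sqrtr_sqr ger0_norm.
exact: ler_wsqrtr.
Qed.

(* [dual_le A g c] says that the norm of g dual to the norm of A is at most c;
   phrased by duality, it involves no inverse matrix. *)
Definition dual_le A g c := forall v, dotv g v <= c * lnorm A v.

Lemma dual_le_norm A g c v : dual_le A g c -> `|dotv g v| <= c * lnorm A v.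
Proof.
move=> Ag; rewrite ler_norml Ag andbT lerNl.
by have := Ag (- v); rewrite dotvNr lnormN.
Qed.

Lemma dual_leD A g h a b : dual_le A g a -> dual_le A h b -> dual_le A (g + h) (a + b).
Proof. by move=> Ag Ah v; rewrite dotvDl mulrDl lerD. Qed.

Lemma dual_leZ A g a c : 0 <= c -> dual_le A g a -> dual_le A (c *: g) (c * a).
Proof. by move=> c0 Ag v; rewrite dotvZl -mulrA ler_wpM2l. Qed.

Lemma dual_leN A g a : dual_le A g a -> dual_le A (- g) a.
Proof. by move=> Ag v; have := Ag (- v); rewrite dotvNr lnormN dotvNl. Qed.

Lemma dual_leW A g a b : a <= b -> dual_le A g a -> dual_le A g b.
Proof. by move=> ab Ag v; apply: le_trans (Ag v) _; rewrite ler_wpM2r// lnorm_ge0. Qed.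

Lemma dual_le_mx A B g a c : 0 <= a -> (forall v, lnorm A v <= c * lnorm B v) ->
  dual_le A g a -> dual_le B g (c * a).
Proof.
move=> a0 AB Ag v; apply: le_trans (Ag v) _.
by rewrite [c * a]mulrC -mulrA ler_wpM2l.
Qed.

Lemma posdef_unitmx A : posdef A -> A \in unitmx.
Proof.
move=> [As Ap]; rewrite unitmxE unitfE; apply/negP => /det0P[v v0 vA].
have : 0 < qform A v^T by apply: Ap; rewrite trmx_eq0.
by rewrite /qform /dotv trmxK mulmxA vA mul0mx mxE ltxx.
Qed.

Lemma mulmx_invmx A x : posdef A -> A *m (invmx A *m x) = x.
Proof. by move=> /posdef_unitmx Au; rewrite mulmxA mulmxV// mul1mx. Qed.

Lemma qform_invmx A g : posdef A -> qform (invmx A) g = qform A (invmx A *m g).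
Proof. by move=> Ap; rewrite /qform mulmx_invmx// dotvC. Qed.

Lemma dual_le_invmx A g c : posdef A -> lnorm (invmx A) g <= c -> dual_le A g c.
Proof.
move=> Ap gc v.
rewrite -{1}(mulmx_invmx g Ap) dotvC -[dotv _ _]/(bform _ _ _).
apply: le_trans (ler_norm _) _; apply: le_trans (cauchy_schwarz _ _ Ap) _.
rewrite mulrC ler_wpM2r ?lnorm_ge0//; apply: le_trans gc.
by rewrite !lnormE qform_invmx.
Qed.

(** Test the dual bound at [invmx A *m g] itself, where the pairing is the squared norm. *)
Lemma lnorm_invmx_le A g c : posdef A -> 0 <= c -> dual_le A g c ->
  lnorm A (invmx A *m g) <= c.
Proof.
move=> Ap c0 Ag.
have := Ag (invmx A *m g); rewrite -{1}(mulmx_invmx g Ap) dotvC.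
rewrite -[dotv _ _]/(qform _ _) -sqr_lnorm//.
have := lnorm_ge0 A (invmx A *m g); rewrite le_eqVlt => /predU1P[<-//|N0].
by rewrite expr2 ler_pM2r.
Qed.

(* From [T(h + p/2)^3 - T(h - p/2)^3 = 3 T(p,h,h) + T(p,p,p)/4]
   at unit vectors; the optimal constant is 1 rather than 4/3. *)
Lemma trilinear_le A (T : 'cV[R]_d -> 'cV[R]_d -> 'cV[R]_d -> R) c p h : posdef A -> 0 <= c ->
  (forall a u v w z, T (a *: u + v) w z = a * T u w z + T v w z) ->
  (forall u v w, T u v w = T v u w) -> (forall u v w, T u v w = T u w v) ->
  (forall u, `|T u u u| <= c * lnorm A u ^+ 3) ->
  `|T p h h| <= 4 / 3 * c * (lnorm A p * lnorm A h ^+ 2).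
Proof.
move=> Ap c0 Tl T12 T23 Tc.
have Tl2 a u v w z : T w (a *: u + v) z = a * T w u z + T w v z.
  by rewrite T12 Tl !(T12 w).
have Tl3 a u v w z : T w z (a *: u + v) = a * T w z u + T w z v.
  by rewrite T23 Tl2 !(T23 w z).
have T0 w z : T 0 w z = 0.
  have := Tl 1 0 0 w z; rewrite scaler0 addr0 mul1r => /eqP.
  by rewrite -subr_eq0 opprD addrA subrr sub0r oppr_eq0 => /eqP.
have TZ a u w z : T (a *: u) w z = a * T u w z by rewrite -[a *: u]addr0 Tl T0 addr0.
have TZ2 a u w z : T w (a *: u) z = a * T w u z by rewrite T12 TZ T12.
have TZ3 a u w z : T w z (a *: u) = a * T w z u by rewrite T23 TZ2 T23.
have [->|p0] := eqVneq p 0; first by rewrite T0 lnorm0 mul0r mulr0 normr0.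
have [->|h0] := eqVneq h 0.
  by rewrite T12 T0 lnorm0 expr0n !mulr0 normr0.
have As := Ap.1.
have unit_case u v : lnorm A u = 1 -> lnorm A v = 1 -> `|T u v v| <= 4 / 3 * c.
  move=> u1 v1.
  have qu : qform A u = 1 by rewrite -sqr_lnorm// u1 expr1n.
  have qv : qform A v = 1 by rewrite -sqr_lnorm// v1 expr1n.
  have EqT : T ((2^-1 : R) *: u + v) (2^-1 *: u + v) (2^-1 *: u + v)
     - T (- 2^-1 *: u + v) (- 2^-1 *: u + v) (- 2^-1 *: u + v)
     = 3 * T u v v + 4^-1 * T u u u.
    rewrite !(Tl, Tl2, Tl3) (T12 v u v) (T23 v v u) (T12 v u v) (T12 v u u) (T23 u v u).
    by field.
  have Np s : s ^+ 2 = 4^-1 -> lnorm A (s *: u + v) ^+ 2 = 5 / 4 + 2 * s * bform A u v.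
    move=> s2; rewrite sqr_lnorm// qformD// qformZ bformZl qu qv s2; by field.
  have N1 : lnorm A (2^-1 *: u + v) ^+ 2 = 5 / 4 + 2 * 2^-1 * bform A u v.
    by apply: Np; field.
  have N2 : lnorm A (- 2^-1 *: u + v) ^+ 2 = 5 / 4 + 2 * - 2^-1 * bform A u v.
    by apply: Np; field.
  have ub s : `|s| = 2^-1 -> lnorm A (s *: u + v) <= 3 / 2.
    move=> hs; apply: le_trans (lnormD _ _ Ap) _.
    by rewrite lnormZ hs u1 v1 mulr1; lra.
  have h2 : 0 <= (2^-1 : R) by rewrite invr_ge0.
  have U1 := ub 2^-1 (ger0_norm h2).
  have U2 := ub (- 2^-1) (etrans (normrN _) (ger0_norm h2)).
  have B1 := Tc (2^-1 *: u + v); have B2 := Tc (- 2^-1 *: u + v).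
  have B3 := Tc u.
  have P1 := lnorm_ge0 A (2^-1 *: u + v); have P2 := lnorm_ge0 A (- 2^-1 *: u + v).
  move: EqT B1 B2 B3 U1 U2 N1 N2 P1 P2; rewrite u1 expr1n mulr1.
  move: (T _ _ _) (T _ (- _ *: _ + _) _) (T u u u) (T u v v) (bform A u v) (lnorm A (2^-1 *: u + v))
    (lnorm A (- 2^-1 *: u + v)) => t1 t2 t3 t4 b m1 m2 EqT B1 B2 B3 U1 U2 N1 N2 P1 P2.
  (* Both norms are at most 3/2 and their squares add up to 5/2, so their cubes add up to at most
     15/4. With 1/4 from [T u u u], this yields [3 |T u v v| <= 4 c]. *)
  have C1 : m1 ^+ 3 <= 3 / 2 * m1 ^+ 2 by rewrite exprS ler_wpM2r// sqr_ge0.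
  have C2 : m2 ^+ 3 <= 3 / 2 * m2 ^+ 2 by rewrite exprS ler_wpM2r// sqr_ge0.
  have C3 : m1 ^+ 3 + m2 ^+ 3 <= 15 / 4 by rewrite N1 in C1; rewrite N2 in C2; lra.
  have C4 : c * m1 ^+ 3 + c * m2 ^+ 3 <= c * (15 / 4) by rewrite -mulrDr ler_wpM2l.
  move: B1 B2 B3; rewrite !ler_norml => /andP[? ?] /andP[? ?] /andP[? ?].
  apply/andP; split; lra.
have Nx := lnorm_gt0 Ap p0; have Ny := lnorm_gt0 Ap h0.
have nu z : z != 0 -> lnorm A ((lnorm A z)^-1 *: z) = 1.
  move=> z0; have Nz := lnorm_gt0 Ap z0.
  by rewrite lnormZ gtr0_norm ?invr_gt0// mulVf// gt_eqF.
have := unit_case _ _ (nu p p0) (nu h h0).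
rewrite TZ TZ2 TZ3 mulrA mulrA normrM gtr0_norm ?mulr_gt0 ?invr_gt0//.
rewrite -mulrA -!invfM ler_pdivrMl ?mulr_gt0// expr2 => H.
by rewrite [leRHS]mulrC.
Qed.

End Forms.

(** * Derivatives along lines *)

Section DerivativesAlongLines.
Context {R : realType} {d : nat}.
Implicit Types (f : 'cV[R]_d -> R) (x u v w z : 'cV[R]_d) (U : set 'cV[R]_d).

Lemma is_derive_lincomb (V : normedModType R) n (c dh : 'I_n -> R) (h : 'I_n -> V -> R) (x v : V) :
  (forall i, is_derive x v (h i) (dh i)) ->
  is_derive x v (fun y => \sum_i c i * h i y) (\sum_i c i * dh i).
Proof.
move=> H.
have -> : (fun y => \sum_i c i * h i y) = \sum_i (c i \*: h i).
  by apply/funext => y; rewrite fct_sumE.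
by apply: is_derive_sum => i; have := H i => Hi; exact: is_deriveZ.
Qed.

Lemma sum2_swap (a b : 'I_d -> R) (D : 'I_d -> 'I_d -> R) :
  \sum_i a i * \sum_j b j * D i j = \sum_j b j * \sum_i a i * D i j.
Proof.
under eq_bigr do rewrite mulr_sumr; rewrite exchange_big.
by apply: eq_bigr => j _; rewrite mulr_sumr; apply: eq_bigr => i _; rewrite mulrCA.
Qed.

(** [u] goes with the first index [k], the outermost derivative, yet is summed innermost: this is
    the shape produced by differentiating the Hessian form of [v] and [w] in the direction [u]. *)
Definition tri3 (D : 'I_d -> 'I_d -> 'I_d -> R) u v w :=
  \sum_i v i 0 * \sum_j w j 0 * \sum_k u k 0 * D k i j.

Lemma tri3_12 D u v w : (forall k i j, D k i j = D i k j) ->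
  tri3 D u v w = tri3 D v u w.
Proof.
move=> DC; rewrite /tri3.
transitivity (\sum_i \sum_k \sum_j v i 0 * w j 0 * u k 0 * D k i j).
  apply: eq_bigr => i _; rewrite exchange_big mulr_sumr; apply: eq_bigr => j _.
  by rewrite !mulr_sumr; apply: eq_bigr => k _; rewrite !mulrA.
rewrite exchange_big; apply: eq_bigr => k _; rewrite exchange_big mulr_sumr.
apply: eq_bigr => j _; rewrite !mulr_sumr; apply: eq_bigr => i _.
by rewrite DC; ring.
Qed.

Lemma tri3_23 D u v w : (forall k i j, D k i j = D k j i) ->
  tri3 D u v w = tri3 D u w v.
Proof.
move=> DC; rewrite /tri3 (sum2_swap _ _ (fun i j => \sum_k u k 0 * D k i j)).
apply: eq_bigr => i _; congr (_ * _); apply: eq_bigr => j _; congr (_ * _).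
by apply: eq_bigr => k _; rewrite DC.
Qed.

Lemma tri3_linear D a u v w z :
  tri3 D (a *: u + v) w z = a * tri3 D u w z + tri3 D v w z.
Proof.
rewrite /tri3 mulr_sumr -big_split; apply: eq_bigr => i _ /=.
rewrite mulrCA -mulrDr; congr (_ * _).
rewrite mulr_sumr -big_split; apply: eq_bigr => j _ /=.
rewrite mulrCA -mulrDr; congr (_ * _).
rewrite mulr_sumr -big_split; apply: eq_bigr => k _ /=.
by rewrite !mxE mulrDl mulrA.
Qed.

Definition trif f x := tri3 (fun k i j => pderiv k (pderiv i (pderiv j f)) x).

Lemma dotv_gradE f x v : dotv (grad f x) v = \sum_i v i 0 * pderiv i f x.
Proof. by rewrite dotvE; apply: eq_bigr => i _; rewrite mxE mulrC. Qed.

Lemma bform_hessE f x v w :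
  bform (hess f x) v w = \sum_i v i 0 * \sum_j w j 0 * pderiv i (pderiv j f) x.
Proof.
rewrite /bform dotvE; apply: eq_bigr => i _; rewrite mxE; congr (_ * _).
by apply: eq_bigr => j _; rewrite mxE mulrC.
Qed.

Lemma third_formE f x u : third_form f x u = trif f x u u u.
Proof.
rewrite /third_form /trif exchange_big /=; apply: eq_bigr => i _.
rewrite mulr_sumr exchange_big; apply: eq_bigr => j _.
rewrite mulrA mulr_sumr; apply: eq_bigr => k _.
by rewrite [RHS]mulrC [X in X * _]mulrC [RHS]mulrC; ring.
Qed.

Lemma is_derive_dotv_grad U f x v w : open U -> U x -> Ck 2 U f ->
  is_derive x v (fun y => dotv (grad f y) w) (bform (hess f x) v w).
Proof.
move=> oU Ux fC.
have -> : bform (hess f x) v w = \sum_i w i 0 * \sum_j v j 0 * pderiv j (pderiv i f) x.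
  rewrite bform_hessE.
  exact: (sum2_swap (v ^~ 0) (w ^~ 0) (fun i j => pderiv i (pderiv j f) x)).
have -> : (fun y => dotv (grad f y) w) = (fun y => \sum_i w i 0 * pderiv i f y).
  by apply/funext => y; rewrite dotv_gradE.
by apply: is_derive_lincomb => i; exact: is_derive_grad oU Ux (Ck_pderiv i fC).
Qed.

Lemma is_derive_bform_hess U f x v w z : open U -> U x -> Ck 3 U f ->
  is_derive x v (fun y => bform (hess f y) w z) (trif f x v w z).
Proof.
move=> oU Ux fC.
have -> : (fun y => bform (hess f y) w z) =
    (fun y => \sum_i w i 0 * \sum_j z j 0 * pderiv i (pderiv j f) y).
  by apply/funext => y; rewrite bform_hessE.
apply: is_derive_lincomb => i; apply: is_derive_lincomb => j.
exact: is_derive_grad oU Ux (Ck_pderiv i (Ck_pderiv j fC)).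
Qed.

Lemma trif12 U f x u v w : open U -> U x -> Ck 3 U f ->
  trif f x u v w = trif f x v u w.
Proof.
move=> oU Ux fC; apply: tri3_12 => k i j.
exact: pderivC oU Ux (Ck_pderiv j fC).
Qed.

(** Exchanging the two inner derivatives takes place under an outer derivative, so Schwarz's theorem
    is needed on a neighbourhood of [x] and not just at [x]. *)
Lemma trif23 U f x u v w : open U -> U x -> Ck 3 U f ->
  trif f x u v w = trif f x u w v.
Proof.
move=> oU Ux fC; apply: tri3_23 => k i j; apply: near_eq_derive.
have : nbhs x U by exact: open_nbhs_nbhs.
by apply: filterS => y Uy; exact: pderivC oU Uy (CkW fC).
Qed.

Lemma hess_sym U f x : open U -> U x -> Ck 2 U f -> (hess f x)^T = hess f x.
Proof.
by move=> oU Ux fC; apply/matrixP => i j; rewrite !mxE; exact: pderivC oU Ux fC.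
Qed.

Lemma line_grad U f x u (t : R) : open U -> U (x + t *: u) -> Ck 1 U f ->
  is_derive t 1 (fun s => f (x + s *: u)) (dotv (grad f (x + t *: u)) u).
Proof.
move=> oU Ux fC; apply: is_derive_line; rewrite dotv_gradE.
exact: is_derive_grad oU Ux fC.
Qed.

Lemma line_hess U f x u w (t : R) : open U -> U (x + t *: u) -> Ck 2 U f ->
  is_derive t 1 (fun s => dotv (grad f (x + s *: u)) w)
    (bform (hess f (x + t *: u)) u w).
Proof.
move=> oU Ux fC; apply: (is_derive_line (f := fun y => dotv (grad f y) w)).
exact: is_derive_dotv_grad oU Ux fC.
Qed.

Lemma line_third U f x u w z (t : R) : open U -> U (x + t *: u) -> Ck 3 U f ->
  is_derive t 1 (fun s => bform (hess f (x + s *: u)) w z)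
    (trif f (x + t *: u) u w z).
Proof.
move=> oU Ux fC; apply: (is_derive_line (f := fun y => bform (hess f y) w z)).
exact: is_derive_bform_hess oU Ux fC.
Qed.

End DerivativesAlongLines.

(** * Segments in open sets and in convex sets *)

Section Segments.
Context {R : realType} {V : normedModType R}.
Implicit Types (x y u : V) (O : set V).

Lemma open_line O x u (b : R) : open O -> O (x + b *: u) ->
  exists2 r : R, 0 < r & forall t, `|t - b| < r -> O (x + t *: u).
Proof.
move=> oO Ob; have : nbhs (x + b *: u) O by exact: open_nbhs_nbhs.
rewrite -nbhs_ballE => -[e /= e0 H].
have u1 : 0 < `|u| + 1 by rewrite ltr_wpDl.
exists (e / (`|u| + 1)); first by rewrite divr_gt0.
move=> t; rewrite ltr_pdivlMr// => tb; apply: H; rewrite -ball_normE /=.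
rewrite opprD addrACA subrr add0r -scalerBl normrZ distrC.
by apply: le_lt_trans tb; rewrite ler_wpM2l// lerDl.
Qed.

(** [b] is the infimum of the parameters outside [O]; openness of [O] puts [b] itself outside. *)
Lemma exit_segment O x u : open O -> O x -> ~ O (x + u) ->
  exists b : R, [/\ 0 < b, b <= 1, (forall t, 0 <= t < b -> O (x + t *: u))
    & ~ O (x + b *: u)].
Proof.
move=> oO Ox Ou.
pose S := [set t : R | 0 <= t <= 1 /\ ~ O (x + t *: u)].
have S1 : S 1 by split; rewrite ?ler01 ?lexx// scale1r.
have Slb : lbound S 0 by move=> t [/andP[]].
have Sinf : has_inf S by split; [exists 1|exists 0].
have Slow t : S t -> inf S <= t by apply: ge_inf; exists 0.
have inf1 := Slow _ S1.
have b0 : 0 <= inf S by apply: lb_le_inf => //; exists 1.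
have bO : ~ O (x + inf S *: u).
  move=> Ob; have [r r0 rO] := open_line oO Ob.
  have [s Ss sr] := inf_adherent r0 Sinf.
  case: (Ss) => _; apply; apply: rO; rewrite ger0_norm ?subr_ge0 ?Slow//.
  by rewrite ltrBlDl.
exists (inf S); split => //; last first.
- move=> t /andP[t0 tb]; apply: contrapT => tO.
  have : inf S <= t by apply: Slow; split=> //; rewrite t0 (le_trans (ltW tb)).
  by rewrite leNgt tb.
- rewrite lt_neqAle b0 andbT eq_sym; apply/eqP => bE; apply: bO.
  by rewrite bE scale0r addr0.
Qed.

(** The homothety of ratio [1 - t] centred at [y] maps a ball around [x] inside [K] to a ball around
    the new point; [x'] is the preimage of [w]. The endpoint [y] may lie on the boundary. *)
Lemma interior_segment (K : set V) x y (t : R) : convex_set K ->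
  interior K x -> K y -> 0 <= t < 1 -> interior K (x + t *: (y - x)).
Proof.
move=> cK; rewrite /interior -nbhs_ballE => -[r /= r0 xr] Ky /andP[t0 t1].
have s0 : 0 < 1 - t by rewrite subr_gt0.
exists (r * (1 - t)); first by rewrite /= mulr_gt0.
move=> w; rewrite -ball_normE /= => wr.
pose x' := x + (1 - t)^-1 *: (w - (x + t *: (y - x))).
have Kx' : K x'.
  apply: xr; rewrite -ball_normE /= /x' opprD addrA subrr add0r normrN normrZ.
  by rewrite gtr0_norm ?invr_gt0// ltr_pdivrMl// distrC mulrC.
have i1 : (1 - t) <= 1 by rewrite lerBlDr lerDl.
have := cK x' y (Itv01 (ltW s0) i1); rewrite !inE => /(_ Kx' Ky).
suff -> : conv (Itv01 (ltW s0) i1) (x' : convex_lmodType V) y = w by [].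
have E : x + t *: (y - x) = (1 - t) *: x + t *: y.
  by rewrite scalerBr scalerBl scale1r addrCA addrC.
rewrite -[LHS]/((1 - t) *: x' + (1 - (1 - t)) *: y) subKr /x' scalerDr scalerA divff ?gt_eqF// scale1r E.
by rewrite addrAC addrC subrK.
Qed.

End Segments.

(** * Self-concordance *)

Section SelfConcordant.
Context {R : realType} {d : nat}.
Variables (K : set 'cV[R]_d) (M : R).
Implicit Types (f : 'cV[R]_d -> R) (x y u v w z : 'cV[R]_d).

Let oK : open (interior K). Proof. exact: open_interior. Qed.

(** Only unboundedness before the exit from a segment is retained from the boundary condition. This
    form passes immediately to [f] plus a nonnegative function. *)
Definition blows_up f := forall x u, interior K x -> ~ interior K (x + u) ->
  exists b : R, [/\ 0 < b, b <= 1, (forall t, 0 <= t < b -> interior K (x + t *: u))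
    & forall B : R, exists2 t, 0 <= t < b & B < f (x + t *: u)].

Lemma self_concordant_blows_up f : self_concordant K M f -> blows_up f.
Proof.
move=> [_ _ _ bu _] x u Kx Ku.
have [b [b0 b1 bK bu']] := exit_segment oK Kx Ku.
exists b; split=> // B.
(* [harmonic n] is [1 / (n + 1)], so [t_] starts at 0 and tends to [b] from below. *)
pose t_ n : R := b - b * harmonic n.
have t01 n : 0 <= t_ n < b.
  have h0 : 0 < harmonic n :> R by rewrite invr_gt0.
  have h1 : harmonic n <= 1 :> R by rewrite invf_le1// ler1n.
  by rewrite /t_ subr_ge0 ler_piMr ?(ltW b0)//= ltrBlDr ltrDl mulr_gt0.
have tcvg : (fun n => x + t_ n *: u) @ \oo --> x + b *: u.
  apply: cvgD; first exact: cvg_cst.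
  apply: cvgZl; rewrite -[X in _ --> X]subr0 -(mulr0 b).
  by apply: cvgB; [exact: cvg_cst|apply: cvgMr; exact: cvg_harmonic].
have Kt n : interior K (x + t_ n *: u) by apply: bK.
have cl : (closure K `\` interior K) (x + b *: u).
  split=> // A nA; have [N _ HN] : \forall n \near \oo, A (x + t_ n *: u) by exact: tcvg.
  exists (x + t_ N *: u); split; last by apply: HN => /=.
  exact: interior_subset (Kt N).
have /cvgryPgt/(_ B)[N _ HN] := bu _ _ Kt cl tcvg.
by exists (t_ N) => //; apply: HN => /=.
Qed.

Lemma convex_function_le f x y (t : R) : convex_function (interior K) f ->
  interior K x -> interior K y -> 0 <= t <= 1 ->
  f (t *: x + (1 - t) *: y) <= t * f x + (1 - t) * f y.
Proof.
move=> cf Kx Ky /andP[t0 t1].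
have := cf (Itv01 t0 t1) x y; rewrite !inE => /(_ Kx Ky).
by [].
Qed.

(** If the second derivative [q 0] along [v] were negative, then [q <= q 0 / 2] near 0. The
    symmetric sum [f (x + t v) + f (x - t v)] would then fall below [2 f x] by at least
    [- q 0 / 2 * t^2], against midpoint convexity. *)
Lemma convex_hess_ge0 f x v : convex_function (interior K) f ->
  Ck 3 (interior K) f -> interior K x -> 0 <= qform (hess f x) v.
Proof.
move=> cf fC Kx; rewrite leNgt; apply/negP => q0.
have fC2 := CkW fC; have fC1 := CkW fC2.
have Kx0 : interior K (x + (0 : R) *: v) by rewrite scale0r addr0.
have [r1 r10 Kr] := open_line oK Kx0.
pose q t := bform (hess f (x + t *: v)) v v.
pose g t := dotv (grad f (x + t *: v)) v.
have qc : {for (0 : R), continuous q}.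
  apply/differentiable_continuous/derivable1_diffP.
  by have := line_third v v oK Kx0 fC => -[].
have q00 : q 0 < 0 by rewrite /q scale0r addr0.
have mq : 0 < - q 0 / 2 by rewrite divr_gt0// oppr_gt0.
have [r2 r20 qr] := @continuous_ball R R^o q 0 setT _ (openT) I qc mq.
pose r := Num.min r1 r2 / 2.
have r0 : 0 < r by rewrite divr_gt0// lt_min r10.
have rr1 : r < r1 by rewrite ltr_pdivrMr// gt_min (_ : r1 < r1 * 2)// ltr_pMr// ltr1n.
have rr2 : r < r2 by rewrite ltr_pdivrMr// gt_min (_ : r2 < r2 * 2) ?orbT// ltr_pMr// ltr1n.
have Kt t : - r <= t <= r -> interior K (x + t *: v).
  by move=> tr; apply: Kr; rewrite subr0; apply: le_lt_trans rr1; rewrite ler_norml.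
have qt t : - r <= t <= r -> q t <= q 0 / 2.
  move=> tr; have [|_ ] := qr t.
    by rewrite subr0; apply: le_lt_trans rr2; rewrite ler_norml.
  by move: (q t) (q 0) => a c h; have := le_lt_trans (ler_norm _) h; lra.
have gle t : 0 <= t <= r -> g t - g (- t) <= q 0 * t.
  move=> /andP[t0 tr].
  have tt : - t <= t by lra.
  have [|c /andP[c1 c2] E] := @is_derive_mvt R g q (- t) t tt.
    by move=> s st; apply: line_hess oK _ fC2; apply: Kt; move: st tr => /andP[? ?] ?; lra.
  rewrite -/(g t) E opprK.
  have := qt c _; rewrite (_ : t + t = t * 2); last by ring.
  move=> H; have {}H : q c <= q 0 / 2.
    by apply: H; apply/andP; split; clear -t0 tr c1 c2; lra.
  by have := ler_wpM2r t0 H; move: (q c) (q 0) => a1 a2; clear; lra.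
pose G t := f (x + t *: v) + f (x + t *: (- v)) - q 0 / 2 * t ^+ 2.
have Gd t : 0 <= t <= r -> is_derive t 1 G (g t - g (- t) - q 0 * t).
  move=> /andP[t0 tr].
  have K1 : interior K (x + t *: v) by apply: Kt; lra.
  have K2 : interior K (x + t *: - v) by rewrite scalerN -scaleNr; apply: Kt; lra.
  have d1 := line_grad oK K1 fC1; have d2 := line_grad oK K2 fC1.
  have d3 : is_derive t 1 (fun t : R => q 0 / 2 * t ^+ 2) (q 0 * t).
    by apply: is_derive_eq; rewrite /GRing.scale/=; move: (q 0) => a; field.
  apply: is_derive_eq.
  by rewrite dotvNr scalerN -scaleNr.
have := is_derive_nincr (ltW r0) Gd => /(_ _)/wrap[].
  by move=> t tr; rewrite subr_le0 gle.
rewrite /G !scale0r expr0n mulr0 subr0 addr0.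
have K1 : interior K (x + r *: v) by apply: Kt; rewrite lexx andbT; lra.
have K2 : interior K (x + r *: - v) by rewrite scalerN -scaleNr; apply: Kt; lra.
have h01 : 0 <= (2^-1 : R) <= 1 by apply/andP; split; lra.
have := convex_function_le cf K1 K2 h01.
have -> : 2^-1 *: (x + r *: v) + (1 - 2^-1) *: (x + r *: - v) = x.
  have -> : (1 - 2^-1 : R) = 2^-1 by field.
  rewrite -scalerDr addrACA scalerN subrr addr0 scalerDr -scalerDl.
  by rewrite (_ : 2^-1 + 2^-1 = 1 :> R) ?scale1r//; field.
have := mulr_gt0 (exprn_gt0 2 r0) mq.
move: (f _) (f (x + _ *: v)) (f x) (q 0) => a1 a2 a3 a4; lra.
Qed.

(* The derivatives of [f] are kept abstract, so that unification never unfolds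
   a directional derivative. *)
Record sc_function f (g : 'cV[R]_d -> 'cV[R]_d) (A : 'cV[R]_d -> 'M[R]_d)
    (T : 'cV[R]_d -> 'cV[R]_d -> 'cV[R]_d -> 'cV[R]_d -> R) : Prop := ScFunction {
  sc_ge0 : 0 <= M;
  sc_blows_up : blows_up f;
  sc_derive1 : forall x u (t : R), interior K (x + t *: u) ->
    is_derive t 1 (fun s => f (x + s *: u)) (dotv (g (x + t *: u)) u);
  sc_derive2 : forall x u w (t : R), interior K (x + t *: u) ->
    is_derive t 1 (fun s => dotv (g (x + s *: u)) w) (bform (A (x + t *: u)) u w);
  sc_derive3 : forall x u w z (t : R), interior K (x + t *: u) ->
    is_derive t 1 (fun s => bform (A (x + s *: u)) w z) (T (x + t *: u) u w z);
  sc_linear : forall x a u v w z, T x (a *: u + v) w z = a * T x u w z + T x v w z;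
  sc_sym12 : forall x u v w, interior K x -> T x u v w = T x v u w;
  sc_sym23 : forall x u v w, interior K x -> T x u v w = T x u w v;
  sc_sym : forall x, interior K x -> (A x)^T = A x;
  sc_qform_ge0 : forall x u, interior K x -> 0 <= qform (A x) u;
  sc_bounded : forall x u, interior K x -> u != 0 ->
    exists s : R, ~ interior K (x + s *: u);
  sc_third : forall x u, interior K x ->
    `|T x u u u| <= 2 * M * lnorm (A x) u ^+ 3 }.

Section Properties.
Variables (f : 'cV[R]_d -> R) (g : 'cV[R]_d -> 'cV[R]_d) (A : 'cV[R]_d -> 'M[R]_d).
Variable T : 'cV[R]_d -> 'cV[R]_d -> 'cV[R]_d -> 'cV[R]_d -> R.
Hypothesis fS : sc_function f g A T.

Let M0 := sc_ge0 fS.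

Lemma lnorm_line_riccati x u (t : R) : 0 <= t ->
  (forall s, 0 <= s <= t -> interior K (x + s *: u)) ->
  lnorm (A (x + t *: u)) u - lnorm (A x) u
    <= M * t * lnorm (A x) u * lnorm (A (x + t *: u)) u.
Proof.
move=> t0 Ks.
pose phi (s : R) := bform (A (x + s *: u)) u u.
have phiE s : Num.sqrt (phi s) = lnorm (A (x + s *: u)) u by rewrite lnormE.
have phi0 : Num.sqrt (phi 0) = lnorm (A x) u by rewrite phiE scale0r addr0.
rewrite -phi0 -phiE.
apply: (@riccati R phi (fun s => T (x + s *: u) u u u) M t M0 t0) => s st.
- by apply: (sc_derive3 fS); exact: Ks.
- by apply: (sc_qform_ge0 fS); exact: Ks.
- by rewrite phiE; apply: (sc_third fS) => //; exact: Ks.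
Qed.

Lemma lnorm_line_le x u (t : R) : 0 <= t <= 1 ->
  (forall s, 0 <= s <= t -> interior K (x + s *: u)) ->
  M * lnorm (A x) u < 1 ->
  lnorm (A (x + t *: u)) u
    <= lnorm (A x) u / (1 - M * lnorm (A x) u).
Proof.
move=> /andP[t0 t1] Ks Mu; have := lnorm_line_riccati t0 Ks.
move: Mu (lnorm_ge0 (A x) u) (lnorm_ge0 (A (x + t *: u)) u).
move: (lnorm (A (x + t *: u)) u) (lnorm (A x) u) => q r Mr r0 q0.
rewrite ler_pdivlMr ?subr_gt0// => h.
have : M * t * r * q <= M * r * q.
  by rewrite -!mulrA ler_wpM2l// ler_piMl ?mulr_ge0.
rewrite mulrBr mulr1 [q * _]mulrC; lra.
Qed.

(** A crude Taylor bound whose right-hand side does not depend on [t]: bounded curvature up to the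
    exit time keeps [f] bounded there, contradicting [blows_up]. *)
Lemma line_le_bound x u (t B : R) : 0 <= t <= 1 -> 0 <= B ->
  (forall s, 0 <= s <= t -> interior K (x + s *: u)) ->
  (forall s, 0 <= s <= t -> qform (A (x + s *: u)) u <= B) ->
  f (x + t *: u) <= f x + `|dotv (g x) u| + B.
Proof.
move=> /andP[t0 t1] B0 Ks HB.
have [|c /andP[c0 ct] E] := @is_derive_mvt R (fun s => f (x + s *: u))
   (fun s => dotv (g (x + s *: u)) u) 0 t t0.
  by move=> s st; apply: (sc_derive1 fS); exact: Ks.
have [|e /andP[e0 ec] E2] := @is_derive_mvt R (fun s => dotv (g (x + s *: u)) u)
   (fun s => bform (A (x + s *: u)) u u) 0 c c0.
  move=> s /andP[s0 sc]; apply: (sc_derive2 fS); apply: Ks.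
  by rewrite s0 (le_trans sc).
move: E E2; rewrite scale0r addr0 !subr0 => E E2.
have Bc : bform (A (x + e *: u)) u u * c <= B.
  rewrite -[leRHS]mulr1; apply: ler_pM => //; last by rewrite (le_trans ct).
    by apply: (sc_qform_ge0 fS); apply: Ks; rewrite e0 (le_trans ec).
  by apply: HB; rewrite e0 (le_trans ec).
have Hg : dotv (g (x + c *: u)) u <= `|dotv (g x) u| + B.
  have := ler_norm (dotv (g x) u); move: E2 Bc.
  move: (dotv _ _) (dotv (g x) u) (bform _ _ _ * _) => a1 a2 a3 ? ? ?; lra.
have N0 := normr_ge0 (dotv (g x) u).
have : dotv (g (x + c *: u)) u * t <= `|dotv (g x) u| + B.
  apply: le_trans (ler_wpM2r t0 Hg) _.
  by rewrite -[leRHS]mulr1 ler_wpM2l// addr_ge0.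
move: E; move: (f _) (f x) (dotv _ _ * t) (`|_|) => a1 a2 a3 a4 ? ?; lra.
Qed.

(* A direction of degeneracy would make [f] affine up to the boundary. *)
Lemma sc_posdef x : interior K x -> posdef (A x).
Proof.
move=> Kx; split=> [|u u0]; first exact: (sc_sym fS).
rewrite lt_neqAle (sc_qform_ge0 fS)// andbT eq_sym; apply/negP => /eqP q0.
have [s Ks] := sc_bounded fS Kx u0.
have [b [b0 b1 bK bu]] := sc_blows_up fS Kx Ks.
have n0 : lnorm (A x) (s *: u) = 0 by rewrite lnormE qformZ q0 mulr0 sqrtr0.
have [t /andP[t0 tb]] := bu (f x + `|dotv (g x) (s *: u)| + 0).
apply/negP; rewrite -leNgt; apply: line_le_bound => //.
- by rewrite t0 (le_trans (ltW tb)).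
- by move=> e /andP[e0 et]; apply: bK; rewrite e0 (le_lt_trans et).
move=> e /andP[e0 et].
(* Started from norm 0, the Riccati bound keeps the local norm of the direction at 0 along the whole
   segment. *)
have := @lnorm_line_riccati x (s *: u) e e0.
rewrite n0 subr0 mulr0 mul0r => H; rewrite -sqrtr_eq0 -lnormE eq_le lnorm_ge0 andbT.
apply: H => i /andP[i0 ie].
by apply: bK; rewrite i0 (le_lt_trans ie)// (le_lt_trans et).
Qed.

Lemma third_le x u h : interior K x ->
  `|T x u h h| <= 8 / 3 * M * (lnorm (A x) u * qform (A x) h).
Proof.
move=> Kx; have Hp := sc_posdef Kx.
rewrite -sqr_lnorm// (_ : 8 / 3 * M = 4 / 3 * (2 * M)); last by field.
apply: trilinear_le => //; first by rewrite mulr_ge0.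
- by move=> *; exact: (sc_linear fS).
- by move=> *; exact: (sc_sym12 fS).
- by move=> *; exact: (sc_sym23 fS).
- by move=> v; exact: (sc_third fS).
Qed.

(** Before a hypothetical exit, the local norm of [p] stays below [r / (1 - M r)], where [r] is its
    norm at [x]. Hence [f] stays bounded, whereas it must blow up. *)
Lemma dikin_interior x p : interior K x -> M * lnorm (A x) p < 1 ->
  interior K (x + p).
Proof.
move=> Kx Mp; apply: contrapT => Kp.
have [b [b0 b1 bK bu]] := sc_blows_up fS Kx Kp.
pose r := lnorm (A x) p.
have r0 : 0 <= r by exact: lnorm_ge0.
have den : 0 < 1 - M * r by rewrite subr_gt0.
have [t /andP[t0 tb]] := bu (f x + `|dotv (g x) p| + (r / (1 - M * r)) ^+ 2).
apply/negP; rewrite -leNgt; apply: line_le_bound; rewrite ?sqr_ge0//.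
- by rewrite t0 (le_trans (ltW tb)).
- by move=> s /andP[s0 st]; apply: bK; rewrite s0 (le_lt_trans st).
move=> s /andP[s0 st].
have Ks e : 0 <= e <= s -> interior K (x + e *: p).
  by move=> /andP[e0 es]; apply: bK; rewrite e0 (le_lt_trans es)// (le_lt_trans st).
rewrite -sqr_lnorm; last by apply: sc_posdef => //; apply: Ks; rewrite lexx s0.
rewrite lerXn2r ?nnegrE ?lnorm_ge0 ?divr_ge0 ?(ltW den)//.
apply: lnorm_line_le => //.
by rewrite s0 (le_trans st)// (le_trans (ltW tb)).
Qed.

(** Along the segment, the logarithmic derivative of the Hessian form at [h] is at most [8/3 M]
    times the local norm of [p], hence at most [lam]; Gronwall concludes. The exponential replaces
    the sharp factor [(1 - M r)^(-2)]. *)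
Lemma sc_stable x p h (lam := 8 / 3 * (M * lnorm (A x) p)
    / (1 - M * lnorm (A x) p)) :
  interior K x -> M * lnorm (A x) p < 1 ->
  qform (A (x + p)) h <= expR lam * qform (A x) h /\
  qform (A x) h <= expR lam * qform (A (x + p)) h.
Proof.
move=> Kx Mp.
have r0 := lnorm_ge0 (A x) p.
have Ks s : 0 <= s <= 1 -> interior K (x + s *: p).
  move=> /andP[s0 s1]; apply: dikin_interior => //.
  rewrite lnormZ ger0_norm//; apply: le_lt_trans Mp.
  by rewrite ler_wpM2l// ler_piMl.
have := @gronwall R (fun s => bform (A (x + s *: p)) h h)
  (fun s => T (x + s *: p) p h h) lam 1 ler01.
rewrite scale1r scale0r addr0 mulr1; apply.
  by move=> s s01; apply: (sc_derive3 fS); exact: Ks.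
move=> s s01; apply: le_trans (third_le _ _ (Ks s s01)) _.
rewrite mulrA ler_wpM2r ?posdef_ge0//; first by apply: sc_posdef => //; exact: Ks.
have /andP[s0 s1] := s01.
have Ks' e : 0 <= e <= s -> interior K (x + e *: p).
  by move=> /andP[e0 es]; apply: Ks; rewrite e0 (le_trans es).
have H := lnorm_line_le s01 Ks' Mp.
rewrite (_ : lam = 8 / 3 * M * (lnorm (A x) p / (1 - M * lnorm (A x) p))).
  by rewrite ler_wpM2l// mulr_ge0.
by rewrite /lam; ring.
Qed.

End Properties.
End SelfConcordant.

(** * Bregman divergence and barriers *)

(** With [G = f'], [q = f''] and [q' = f'''] on a line, the derivative of [G^2 / q] is
    [2 G - G^2 q' / q^2]. The barrier bound on one factor [G] and self-concordance make it at least
    [2 (1 - rt M) G]. *)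
Lemma quotient_derive_le0 (R : realType) (M rt n G q q' : R) :
  0 <= M -> 0 <= rt -> rt * M < 1 -> 0 <= G -> 0 < q -> 0 <= n -> n ^+ 2 = q ->
  G <= rt * n -> q' <= 2 * M * n ^+ 3 ->
  G - (2 * (1 - rt * M))^-1 * (2 * G * q * q^-1 + G ^+ 2 * (- q ^- 2 * q')) <= 0.
Proof.
move=> M0 rt0 rtM G0 q0 n0 nq Gn q'n.
have c0 : 0 < 2 * (1 - rt * M) by rewrite mulr_gt0// subr_gt0.
have np : 0 < n.
  rewrite lt_neqAle n0 andbT eq_sym; apply: contraTneq q0 => n00.
  by rewrite -nq n00 expr0n ltxx.
have qi : 0 <= q ^- 2 by rewrite invr_ge0 sqr_ge0.
have H : G ^+ 2 * (q ^- 2 * q') <= 2 * rt * M * G.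
  apply: le_trans (_ : G ^+ 2 * (q ^- 2 * (2 * M * n ^+ 3)) <= _).
    by rewrite ler_wpM2l ?sqr_ge0// ler_wpM2l.
  apply: le_trans (_ : G * (rt * n) * (q ^- 2 * (2 * M * n ^+ 3)) <= _).
    by rewrite ler_wpM2r ?mulr_ge0 ?exprn_ge0// expr2 ler_wpM2l.
  by rewrite -nq le_eqVlt; apply/orP; left; apply/eqP; field; rewrite gt_eqF.
rewrite subr_le0 ler_pdivlMl// mulfK ?gt_eqF// mulNr mulrN.
by move: H; move: (G ^+ 2 * _) => a; lra.
Qed.

Section Barrier.
Context {R : realType} {d : nat}.
Variables (K : set 'cV[R]_d) (M : R).
Hypothesis cK : convex_set K.
Variables (f : 'cV[R]_d -> R) (g : 'cV[R]_d -> 'cV[R]_d) (A : 'cV[R]_d -> 'M[R]_d).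
Variable T : 'cV[R]_d -> 'cV[R]_d -> 'cV[R]_d -> 'cV[R]_d -> R.
Hypothesis fS : sc_function K M f g A T.
Implicit Types (x y u v w z p : 'cV[R]_d).

Let M0 := sc_ge0 fS.

Lemma segment_interior x y (s : R) : interior K x -> interior K y -> 0 <= s <= 1 ->
  interior K (x + s *: (y - x)).
Proof.
move=> Kx Ky /andP[s0]; rewrite le_eqVlt => /predU1P[->|s1].
  by rewrite scale1r addrC subrK.
by apply: interior_segment => //; [exact: interior_subset Ky|rewrite s0].
Qed.

Lemma grad_mvt x y v : interior K x -> interior K y ->
  exists z, [/\ interior K z, (exists2 c : R, 0 <= c <= 1 & z = x + c *: (y - x)) &
    dotv (g y) v - dotv (g x) v = bform (A z) (y - x) v].
Proof.
move=> Kx Ky.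
have [|c c01] := @is_derive_mvt R (fun s => dotv (g (x + s *: (y - x))) v)
   (fun s => bform (A (x + s *: (y - x))) (y - x) v) 0 1 ler01.
  by move=> s s01; apply: (sc_derive2 fS); exact: segment_interior.
rewrite scale1r scale0r addr0 subr0 mulr1 (addrC x) subrK => E.
by exists (x + c *: (y - x)); split => //; [exact: segment_interior|exists c].
Qed.

Lemma grad_line_le x u (a b : R) : a <= b ->
  (forall s, a <= s <= b -> interior K (x + s *: u)) ->
  dotv (g (x + a *: u)) u <= dotv (g (x + b *: u)) u.
Proof.
move=> ab Ks; apply: (@is_derive_ndecr R (fun s => dotv (g (x + s *: u)) u)
   (fun s => bform (A (x + s *: u)) u u)) => // s st.
  by apply: (sc_derive2 fS); exact: Ks.
by apply: (sc_qform_ge0 fS); exact: Ks.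
Qed.

Definition bregman y x := f y - f x - dotv (g x) (y - x).

(** On the first fraction [t] of the segment, the local norm of [y - x] stays at least half its
    value [r] at [x], so the curvature is at least [r^2 / 4]; afterwards the slope only increases.
    Taking [t = 1] gives quadratic growth for near points, and [t = 1 / (M r)] linear growth for far
    ones. *)
Lemma bregman_lower x y (t : R) : interior K x -> interior K y ->
  0 <= t <= 1 -> M * t * lnorm (A x) (y - x) <= 1 ->
  t * lnorm (A x) (y - x) ^+ 2 / 8 <= bregman y x.
Proof.
move=> Kx Ky /andP[t0 t1] Mr.
rewrite /bregman; have Ey : y = x + 1 *: (y - x) by rewrite scale1r addrC subrK.
have Kp s : 0 <= s <= 1 -> interior K (x + s *: (y - x)) by exact: segment_interior.
move: (y - x) Mr Kp Ey => p Mr Kp ->.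
have r0 := lnorm_ge0 (A x) p.
(* The Riccati bound is applied backwards, from [x + s p] to [x]: it gives
   [r - q <= M s q r <= q]. *)
have q_ge s : 0 <= s <= t -> lnorm (A x) p ^+ 2 / 4 <= bform (A (x + s *: p)) p p.
  move=> /andP[s0 st].
  have s1 : s <= 1 := le_trans st t1.
  have Ks e : 0 <= e <= s -> interior K (x + s *: p + e *: - p).
    move=> /andP[e0 es]; rewrite -addrA scalerN -scalerBl; apply: Kp.
    by rewrite subr_ge0 es (le_trans _ s1)// lerBlDr lerDl.
  have := lnorm_line_riccati fS s0 Ks.
  rewrite -addrA scalerN subrr addr0 !lnormN => H.
  have Ps : posdef (A (x + s *: p)).
    by apply: (sc_posdef fS); apply: Kp; rewrite s0.
  rewrite -[bform _ _ _]/(qform _ _) -sqr_lnorm//.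
  have q0 := lnorm_ge0 (A (x + s *: p)) p.
  move: (lnorm (A (x + s *: p)) p) (lnorm (A x) p) q0 r0 Mr H => q r q0 r0 Mr H.
  have : M * s * q * r <= q.
    rewrite mulrAC -[leRHS]mul1r ler_wpM2r//; apply: le_trans Mr.
    by rewrite ler_wpM2r// ler_wpM2l.
  move=> H2; have rq : r <= 2 * q by lra.
  have : r ^+ 2 <= (2 * q) ^+ 2 by rewrite lerXn2r ?nnegrE ?mulr_ge0.
  rewrite exprMn; lra.
have G_ge s : 0 <= s <= t ->
    dotv (g x) p + s * (lnorm (A x) p ^+ 2 / 4) <= dotv (g (x + s *: p)) p.
  move=> /andP[s0 st].
  have [|c /andP[c0 cs]] := @is_derive_mvt R (fun s => dotv (g (x + s *: p)) p)
     (fun s => bform (A (x + s *: p)) p p) 0 s s0.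
    move=> e /andP[e0 es]; apply: (sc_derive2 fS); apply: Kp.
    by rewrite e0 (le_trans es)// (le_trans st).
  rewrite scale0r addr0 subr0 => E.
  have := q_ge c; rewrite c0 (le_trans cs st) => /(_ isT)/(ler_wpM2r s0).
  rewrite -E lerBrDl [s * _]mulrC; exact.
have D1 : f x + t * dotv (g x) p + t ^+ 2 * (lnorm (A x) p ^+ 2 / 8) <= f (x + t *: p).
  pose a := dotv (g x) p; pose b := lnorm (A x) p ^+ 2 / 8.
  have := @is_derive_ndecr R (fun s => f (x + s *: p) - (s * a + s ^+ 2 * b))
    (fun s => dotv (g (x + s *: p)) p - (a + 2 * s * b)) 0 t t0 => /(_ _ _)/wrap[||].
  - move=> s /andP[s0 st].
    have d1 := sc_derive1 fS (Kp s _); have {}d1 := d1 ltac:(by rewrite s0 (le_trans st)).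
    have d2 : is_derive s 1 (fun s : R => s * a + s ^+ 2 * b) (a + 2 * s * b).
      by apply: is_derive_eq; rewrite /GRing.scale/=; ring.
    exact: is_deriveB.
  - move=> s st; have := G_ge s st; rewrite -/a /b subr_ge0.
    by move: (dotv _ _) (lnorm _ _ ^+ 2) => e c; lra.
  rewrite scale0r addr0 mul0r expr0n mul0r addr0 subr0 -/a -/b.
  by move: (f _) (f x) a b => a1 a2 a3 a4; lra.
have D2 : f (x + t *: p) + (1 - t) * (dotv (g x) p + t * (lnorm (A x) p ^+ 2 / 4))
    <= f (x + 1 *: p).
  have [|c /andP[ct c1]] := @is_derive_mvt R (fun s => f (x + s *: p))
     (fun s => dotv (g (x + s *: p)) p) t 1 t1.
    by move=> e /andP[e0 es]; apply: (sc_derive1 fS); apply: Kp; rewrite es (le_trans t0).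
  move=> E.
  have gc : dotv (g x) p + t * (lnorm (A x) p ^+ 2 / 4) <= dotv (g (x + c *: p)) p.
    apply: le_trans (G_ge t _) _; first by rewrite t0 lexx.
    apply: grad_line_le => // e /andP[te ec]; apply: Kp.
    by rewrite (le_trans t0 te) (le_trans ec).
  have s0 : 0 <= 1 - t by rewrite subr_ge0.
  have := ler_wpM2l s0 gc; move: E.
  by move: (f _) (f _) (dotv _ _) (dotv _ _) (lnorm _ _ ^+ 2) => a1 a2 a3 a4 a5; lra.
(* The two stretches contribute [t^2 / 8 + (1 - t) t / 4 = t / 4 - t^2 / 8], which is at least
   [t / 8]. *)
have tt : t * t <= t by rewrite ler_piMl.
have := ler_wpM2r (sqr_ge0 (lnorm (A x) p)) tt.
rewrite scale1r in D2; rewrite expr2 in D1.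
move: D1 D2; rewrite scale1r.
by move: (f _) (f _) (f _) (dotv _ _) (lnorm _ _ ^+ 2) => a1 a2 a3 a4 a5; lra.
Qed.

Lemma bregman_ge0 x y : interior K x -> interior K y -> 0 <= bregman y x.
Proof.
move=> Kx Ky; have := @bregman_lower x y 0 Kx Ky.
rewrite lexx ler01 !(mulr0, mul0r) => /(_ isT); apply; exact: ler01.
Qed.

(** A Fenchel-type bound, meant for the last residual. When [M r <= 1], complete the square in
    [e r - r^2 / 8]; otherwise the divergence is at least [r / (8 M)], which dominates [e r]. *)
Lemma bregman_dual_le x y (e : R) : 0 < M -> interior K x -> interior K y ->
  0 <= e -> 8 * M * e <= 1 -> e * lnorm (A x) (y - x) - bregman y x <= 2 * e ^+ 2.
Proof.
move=> Mp Kx Ky e0 eM; have r0 := lnorm_ge0 (A x) (y - x).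
have [Mr|Mr] := leP (M * lnorm (A x) (y - x)) 1.
  have := @bregman_lower x y 1 Kx Ky; rewrite ler01 lexx !mulr1 => /(_ isT Mr).
  move: (bregman y x) (lnorm _ _) r0 => a r r0.
  by have := sqr_ge0 (r - 4 * e); rewrite sqrrB mul1r; lra.
have r1 : 0 < lnorm (A x) (y - x).
  by rewrite lt_neqAle r0 andbT eq_sym; apply: contraTneq Mr => ->; rewrite mulr0 -leNgt ler01.
have := @bregman_lower x y (M * lnorm (A x) (y - x))^-1 Kx Ky.
rewrite invr_ge0 mulr_ge0 ?(ltW Mp)//= invf_le1 ?mulr_gt0// (ltW Mr) => /(_ isT).
move: (bregman y x) (lnorm _ _) r0 r1 Mr => a r r0 r1 Mr.
rewrite mulrAC divff ?gt_eqF ?mulr_gt0// => /(_ (lexx _)).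
have -> : (M * r)^-1 * r ^+ 2 / 8 = r / (8 * M) by field; rewrite !gt_eqF.
have : e * r <= r / (8 * M).
  by rewrite ler_pdivlMr ?mulr_gt0// mulrAC ler_piMl// mulrC.
by have := sqr_ge0 e; lra.
Qed.

(** * Consequences of the barrier parameter, with [rt] in the role of the square root of [nu] *)

Section BarrierParameter.
Variable rt : R.
Hypothesis rt0 : 0 <= rt.
Hypothesis fB : forall x, interior K x -> dual_le (A x) (g x) rt.

Let grad_sqr_le x u : interior K x -> 0 <= dotv (g x) u ->
  dotv (g x) u ^+ 2 <= rt ^+ 2 * qform (A x) u.
Proof.
move=> Kx gu; rewrite -sqr_lnorm -?exprMn; last exact: (sc_posdef fS Kx).
by rewrite lerXn2r ?nnegrE ?mulr_ge0 ?lnorm_ge0// fB.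
Qed.

(** The slope [G] along the segment satisfies [G^2 <= rt^2 G'], so [1 / G + s / rt^2] is
    nonincreasing. If [G 0 > rt^2], then [1 / G] would be negative at [s = 1]. *)
Lemma barrier_dotv_le x y : interior K x -> interior K y ->
  dotv (g x) (y - x) <= rt ^+ 2.
Proof.
move=> Kx Ky; rewrite leNgt; apply/negP => lt_a.
have Kp s : 0 <= s <= 1 -> interior K (x + s *: (y - x)) by exact: segment_interior.
move: (y - x) lt_a Kp => {Ky y} p lt_a Kp.
have rtp : 0 < rt.
  rewrite lt_neqAle rt0 andbT; apply: contraTneq lt_a => rtE.
  by rewrite -leNgt (le_trans (fB Kx p))// -rtE mul0r expr0n.
have rt2 : 0 < rt ^+ 2 by rewrite exprn_gt0.
have a0 : 0 < dotv (g x) p by exact: lt_trans lt_a.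
have G0 s : 0 <= s <= 1 -> 0 < dotv (g (x + s *: p)) p.
  move=> /andP[s0 s1]; apply: lt_le_trans a0 _.
  have := @grad_line_le x p 0 s s0; rewrite scale0r addr0; apply.
  by move=> e /andP[e0 es]; apply: Kp; rewrite e0 (le_trans es).
pose G s := dotv (g (x + s *: p)) p.
pose q s := bform (A (x + s *: p)) p p.
have := @is_derive_nincr R (fun s => (G s)^-1 + s * (rt ^+ 2)^-1)
  (fun s => - (G s) ^- 2 * q s + (rt ^+ 2)^-1) 0 1 ler01 => /(_ _ _)/wrap[||].
- move=> s s01; have Gn0 : G s != 0 by rewrite gt_eqF ?G0.
  have d1 : is_derive s 1 G (q s) by apply: (sc_derive2 fS); exact: Kp.
  have d2 : is_derive s 1 (fun s => (G s)^-1) (- (G s) ^- 2 * q s).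
    exact: is_deriveV.
  have d3 : is_derive s 1 (fun s : R => s * (rt ^+ 2)^-1) (rt ^+ 2)^-1.
    by apply: is_derive_eq; rewrite /GRing.scale/=; ring.
  exact: is_deriveD.
- move=> s s01; rewrite mulNr addrC subr_le0 ler_pdivlMl ?exprn_gt0 ?G0//.
  rewrite mulrC ler_pdivrMl//; apply: grad_sqr_le; first exact: Kp.
  by rewrite ltW ?G0.
rewrite /G scale0r addr0 mul0r addr0 mul1r.
have i1 : 0 < (dotv (g (x + 1 *: p)) p)^-1 by rewrite invr_gt0 G0// ler01 lexx.
have : (dotv (g x) p)^-1 < (rt ^+ 2)^-1 by rewrite ltf_pV2.
by move: i1; move: (_^-1) (_^-1) (_^-1) => b1 b2 b3; lra.
Qed.

(** [barrier_dotv_le] between the point at parameter [s] and [y] bounds the slope there by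
    [rt^2 / (1 - s)]; integrate over [s]. *)
Lemma barrier_ln_le x y (t : R) : interior K x -> interior K y -> 0 <= t < 1 ->
  f (x + t *: (y - x)) <= f x - rt ^+ 2 * ln (1 - t).
Proof.
move=> Kx Ky /andP[t0 t1].
have Kp s : 0 <= s <= 1 -> interior K (x + s *: (y - x)) by exact: segment_interior.
have := @is_derive_nincr R (fun s => f (x + s *: (y - x)) + rt ^+ 2 * ln (1 - s))
  (fun s => dotv (g (x + s *: (y - x))) (y - x) - rt ^+ 2 / (1 - s)) 0 t t0
  => /(_ _ _)/wrap[||].
- move=> s /andP[s0 st].
  have s1 : 0 < 1 - s by rewrite subr_gt0 (le_lt_trans st).
  have Ks : interior K (x + s *: (y - x)) by apply: Kp; rewrite s0 (le_trans st)// ltW.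
  have d1 := sc_derive1 fS Ks.
  have d2 : is_derive s 1 (fun s : R => 1 - s) (-1).
    by apply: is_derive_eq; ring.
  have d3 : is_derive s 1 (fun s : R => ln (1 - s)) ((1 - s)^-1 * -1).
    have := is_derive1_ln s1 => dl.
    have -> : (fun s : R => ln (1 - s)) = @ln R \o (fun s => 1 - s) by [].
    exact: is_derive1_comp.
  have d4 : is_derive s 1 (fun s : R => rt ^+ 2 * ln (1 - s)) (- (rt ^+ 2 / (1 - s))).
    by apply: is_derive_eq; rewrite /GRing.scale/=; ring.
  exact: is_deriveD.
- move=> s /andP[s0 st].
  have s1 : 0 < 1 - s by rewrite subr_gt0 (le_lt_trans st).
  have Ks : interior K (x + s *: (y - x)) by apply: Kp; rewrite s0 (le_trans st)// ltW.
  rewrite subr_le0 ler_pdivlMr// mulrC -dotvZr.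
  have -> : (1 - s) *: (y - x) = y - (x + s *: (y - x)).
    by rewrite scalerBl scale1r opprD addrA.
  exact: barrier_dotv_le.
rewrite scale0r addr0 subr0 ln1 mulr0 addr0.
by rewrite lerBrDr.
Qed.

(* If [rt * M < 1] then [f], up to a multiple of the bounded quantity
   [f'^2 / f''], decreases along any half-line on which [f] increases. *)
Lemma barrier_parameter_ge1 x u : interior K x -> u != 0 -> 0 <= dotv (g x) u ->
  ~ interior K (x + u) -> 1 <= rt * M.
Proof.
move=> Kx u0 gu Ku; rewrite leNgt; apply/negP => rtM.
have [b [b0 b1 bK bu]] := sc_blows_up fS Kx Ku.
pose c := 1 - rt * M.
have c0 : 0 < c by rewrite subr_gt0.
pose G s := dotv (g (x + s *: u)) u.
pose q s := bform (A (x + s *: u)) u u.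
pose q' s := T (x + s *: u) u u u.
have q0 s : 0 <= s < b -> 0 < q s.
  by move=> sb; apply: (sc_posdef fS (bK s sb)).2.
have G0 s : 0 <= s < b -> 0 <= G s.
  move=> /andP[s0 sb]; apply: le_trans gu _.
  have := @grad_line_le x u 0 s s0; rewrite scale0r addr0; apply.
  by move=> e /andP[e0 es]; apply: bK; rewrite e0 (le_lt_trans es).
have Y_le s : 0 <= s < b -> G s ^+ 2 / q s <= rt ^+ 2.
  by move=> sb; rewrite ler_pdivrMr ?q0//; apply: grad_sqr_le; [exact: bK|exact: G0].
have [t /andP[t0 tb]] := bu (f x + (2 * c)^-1 * rt ^+ 2).
apply/negP; rewrite -leNgt.
have := @is_derive_nincr R (fun s => f (x + s *: u) - (2 * c)^-1 * (G s ^+ 2 * (q s)^-1))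
  (fun s => G s - (2 * c)^-1 * (2 * G s * q s * (q s)^-1 + G s ^+ 2 * (- (q s) ^- 2 * q' s)))
  0 t t0 => /(_ _ _)/wrap[||].
- move=> s /andP[s0 st].
  have sb : 0 <= s < b by rewrite s0 (le_lt_trans st).
  have qn0 : q s != 0 by rewrite gt_eqF ?q0.
  have d1 : is_derive s 1 (fun s => f (x + s *: u)) (G s) := sc_derive1 fS (bK s sb).
  have d2 : is_derive s 1 G (q s) := sc_derive2 fS u (bK s sb).
  have d3 : is_derive s 1 q (q' s) := sc_derive3 fS u u (bK s sb).
  have d4 : is_derive s 1 (fun s => (q s)^-1) (- (q s) ^- 2 * q' s) by exact: is_deriveV.
  have d5 : is_derive s 1 (fun s => G s ^+ 2) (2 * G s * q s).
    by apply: is_derive_eq; rewrite /GRing.scale/=; move: (G s) (q s) => *; ring.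
  have d6 : is_derive s 1 (fun s => G s ^+ 2 * (q s)^-1)
      (2 * G s * q s * (q s)^-1 + G s ^+ 2 * (- (q s) ^- 2 * q' s)).
    apply: is_derive_eq; rewrite /GRing.scale/=.
    by move: (G s) (q s)^-1 (q s) (q' s) (q s ^- 2) => *; ring.
  have d7 : is_derive s 1 (fun s => (2 * c)^-1 * (G s ^+ 2 * (q s)^-1))
      ((2 * c)^-1 * (2 * G s * q s * (q s)^-1 + G s ^+ 2 * (- (q s) ^- 2 * q' s))).
    exact: is_deriveZ.
  exact: is_deriveB.
- move=> s /andP[s0 st].
  have sb : 0 <= s < b by rewrite s0 (le_lt_trans st).
  have Ks := bK s sb; have qp := q0 s sb; have Gp := G0 s sb.
  have Gn : G s <= rt * lnorm (A (x + s *: u)) u by exact: fB.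
  have q3 : q' s <= 2 * M * lnorm (A (x + s *: u)) u ^+ 3.
    exact: le_trans (ler_norm _) (sc_third fS u Ks).
  have n2 : lnorm (A (x + s *: u)) u ^+ 2 = q s := sqr_lnorm u (sc_posdef fS Ks).
  have n0 := lnorm_ge0 (A (x + s *: u)) u.
  exact: (quotient_derive_le0 M0 rt0 rtM Gp qp n0 n2 Gn q3).
rewrite scale0r addr0.
have c20 : 0 <= (2 * c)^-1 by rewrite invr_ge0 mulr_ge0// ltW.
have Yt := Y_le t; rewrite t0 tb in Yt; have {}Yt := ler_wpM2l c20 (Yt isT).
have Y0 : 0 <= (2 * c)^-1 * (G 0 ^+ 2 * (q 0)^-1).
  by rewrite mulr_ge0// mulr_ge0 ?sqr_ge0// invr_ge0 ltW// q0// lexx.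
move: Yt Y0; move: (_ * (G t ^+ 2 / _)) (_ * (G 0 ^+ 2 / _)) (_ * rt ^+ 2) => a1 a2 a3.
by move: (f _) (f _) => a4 a5; lra.
Qed.

End BarrierParameter.
End Barrier.

(** * The regularised barrier *)

Section Instances.
Context {R : realType} {d : nat}.
Variables (K : set 'cV[R]_d) (M : R).
Implicit Types (f : 'cV[R]_d -> R) (x y u v w z : 'cV[R]_d).

Let oK : open (interior K). Proof. exact: open_interior. Qed.

Lemma bounded_exit (r : R) : (forall x, K x -> enorm x <= r) ->
  forall x u, interior K x -> u != 0 -> exists2 s : R, 0 <= s & ~ interior K (x + s *: u).
Proof.
move=> Kr x u Kx u0; have Ip := @posdef1 R d.
have nu0 : 0 < lnorm 1%:M u by exact: lnorm_gt0.
have nx := Kr x (interior_subset Kx); rewrite enormE in nx.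
pose s := (r + lnorm 1%:M x + 1) / lnorm 1%:M u.
have s0 : 0 <= s.
  rewrite divr_ge0 ?(ltW nu0)// !addr_ge0 ?lnorm_ge0//.
  exact: le_trans (lnorm_ge0 _ _) nx.
exists s => // /interior_subset/Kr; rewrite enormE.
apply/negP; rewrite -ltNge.
have := lnormD (x + s *: u) (- x) Ip.
rewrite addrAC subrr add0r lnormN lnormZ ger0_norm//.
by rewrite /s divfK ?gt_eqF//; lra.
Qed.

Lemma self_concordant_sc f : self_concordant K M f ->
  (forall x u, interior K x -> u != 0 -> exists s : R, ~ interior K (x + s *: u)) ->
  sc_function K M f (grad f) (hess f) (trif f).
Proof.
move=> fS bK; have bu := self_concordant_blows_up fS.
have [M0 cf fC3 _ f3] := fS.
have fC2 := CkW fC3; have fC1 := CkW fC2.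
split => //.
- by move=> x u t Kx; exact: line_grad oK Kx fC1.
- by move=> x u w t Kx; exact: line_hess oK Kx fC2.
- by move=> x u w z t Kx; exact: line_third oK Kx fC3.
- by move=> x a u v w z; exact: tri3_linear.
- by move=> x u v w Kx; exact: trif12 oK Kx fC3.
- by move=> x u v w Kx; exact: trif23 oK Kx fC3.
- by move=> x Kx; exact: hess_sym oK Kx fC2.
- by move=> x u Kx; exact: convex_hess_ge0.
- by move=> x u Kx; rewrite -third_formE lnorm_mxnorm; exact: f3.
Qed.

(** A quadratic has no third derivative and only enlarges the Hessian, so [T] and [M] are
    unchanged. *)
Lemma sc_function_quadratic f g A T (c : R) : 0 <= c -> sc_function K M f g A T ->
  sc_function K M (fun x => f x + c / 2 * dotv x x) (fun x => g x + c *: x)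
    (fun x => A x + c *: 1%:M) T.
Proof.
move=> c0 fS; split.
- exact: (sc_ge0 fS).
- move=> x u Kx Ku; have [b [b0 b1 bK bu]] := sc_blows_up fS Kx Ku.
  exists b; split => // B; have [t tb Bt] := bu B; exists t => //.
  by rewrite (lt_le_trans Bt)// lerDl mulr_ge0 ?divr_ge0// dotv_ge0.
- move=> x u t Kx; have d1 := sc_derive1 fS Kx.
  have d2 : is_derive t 1 (fun s => c / 2 * dotv (x + s *: u) (x + s *: u))
      (c * dotv (x + t *: u) u).
    have -> : (fun s => c / 2 * dotv (x + s *: u) (x + s *: u)) =
       (fun s : R => c / 2 * (dotv x x + s * (2 * dotv x u) + s ^+ 2 * dotv u u)).
      apply/funext => s; congr (_ * _).
      rewrite dotvDl !dotvDr !dotvZl !dotvZr (dotvC u x); ring.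
    rewrite dotvDl dotvZl.
    by apply: is_derive_eq; rewrite /GRing.scale/=; field.
  by rewrite dotvDl dotvZl; exact: is_deriveD.
- move=> x u w t Kx; have d1 := sc_derive2 fS w Kx.
  have d2 : is_derive t 1 (fun s => c * dotv (x + s *: u) w) (c * dotv u w).
    have -> : (fun s => c * dotv (x + s *: u) w) =
       (fun s : R => c * (dotv x w + s * dotv u w)).
      by apply/funext => s; rewrite dotvDl dotvZl.
    by apply: is_derive_eq; rewrite /GRing.scale/=; ring.
  rewrite bform_mx [bform 1%:M _ _]/bform mul1mx.
  have -> : (fun s => dotv (g (x + s *: u) + c *: (x + s *: u)) w) =
     (fun s => dotv (g (x + s *: u)) w + c * dotv (x + s *: u) w).
    by apply/funext => s; rewrite dotvDl dotvZl.
  exact: is_deriveD.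
- move=> x u w z t Kx; have d1 := sc_derive3 fS w z Kx.
  have -> : (fun s => bform (A (x + s *: u) + c *: 1%:M) w z) =
     (fun s => bform (A (x + s *: u)) w z + c * bform 1%:M w z).
    by apply/funext => s; rewrite bform_mx.
  by apply: is_derive_eq; rewrite addr0.
- exact: (sc_linear fS).
- exact: (sc_sym12 fS).
- exact: (sc_sym23 fS).
- by move=> x Kx; rewrite linearD linearZ /= trmx1 (sc_sym fS).
- move=> x u Kx; rewrite qform_mx qform1 addr_ge0 ?(sc_qform_ge0 fS)//.
  by rewrite mulr_ge0 ?dotv_ge0.
- exact: (sc_bounded fS).
- move=> x u Kx; apply: le_trans (sc_third fS u Kx) _.
  have M0 := sc_ge0 fS.
  rewrite ler_wpM2l ?mulr_ge0// lerXn2r ?nnegrE ?lnorm_ge0//.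
  rewrite -[leRHS]mul1r lnorm_le// => v.
  by rewrite expr1n mul1r qform_mx lerDl mulr_ge0// qform1 dotv_ge0.
Qed.

Lemma is_derive_coord x v i : is_derive x v (fun y : 'cV[R]_d => y i 0) (v i 0).
Proof.
have H : (fun h : R => h^-1 *: (((fun y : 'cV[R]_d => y i 0) \o shift x) (h *: v) - x i 0))
    @ 0^' --> v i 0.
  apply: cvg_near_cst.
  have : \forall h \near 0^', (h : R) != 0 by exact: nbhs_dnbhs_neq.
  by apply: filterS => h h0; rewrite /= !mxE addrK /GRing.scale /= mulKf.
by split; [apply/cvg_ex; eexists; exact: H|exact: (cvg_lim _ H)].
Qed.

Section Quadratic.
Variables (f : 'cV[R]_d -> R) (c : R).
Let q := fun x : 'cV[R]_d => f x + c / 2 * dotv x x.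
Hypothesis fC : Ck 2 (interior K) f.

Let pderiv_q i x : interior K x -> pderiv i q x = pderiv i f x + c * x i 0.
Proof.
move=> Kx; have d1 := derivableP (Ck_derivable (i := i) fC Kx).
have d2 : is_derive x (evec i) (fun y => \sum_j (y j 0 * y j 0)) (2 * x i 0).
  have -> : (fun y : 'cV[R]_d => \sum_j (y j 0 * y j 0)) =
      \sum_j ((fun y : 'cV[R]_d => y j 0) * (fun y : 'cV[R]_d => y j 0)).
    by apply/funext => y; rewrite fct_sumE.
  have H j := is_deriveM (is_derive_coord x (evec i) j) (is_derive_coord x (evec i) j).
  apply: is_derive_eq (is_derive_sum H) _.
  rewrite (bigD1 i)//= big1 => [|j ji]; last by rewrite mxE (negbTE ji) !scaler0 addr0.
  by rewrite addr0 mxE !eqxx /GRing.scale /=; ring.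
have d3 : is_derive x (evec i) (fun y => c / 2 * dotv y y) (c * x i 0).
  have -> : (fun y : 'cV[R]_d => c / 2 * dotv y y) =
      (c / 2) \*: (fun y : 'cV[R]_d => \sum_j (y j 0 * y j 0)).
    by apply/funext => y; rewrite /= dotvE.
  by apply: is_derive_eq; rewrite /GRing.scale /=; field.
have [_] := is_deriveD d1 d3; exact.
Qed.

Lemma grad_quadratic x : interior K x -> grad q x = grad f x + c *: x.
Proof. by move=> Kx; apply/matrixP => i j; rewrite ord1 !mxE pderiv_q. Qed.

Lemma hess_quadratic x : interior K x -> hess q x = hess f x + c *: 1%:M.
Proof.
move=> Kx; apply/matrixP => i j; rewrite !mxE.
have nK : nbhs x (interior K) by exact: open_nbhs_nbhs.
(* The formula for the inner partial is known only on [interior K], which suffices because a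
   derivative is local. *)
transitivity ('D_(evec i) (fun y => pderiv j f y + c * y j 0) x).
  apply: near_eq_derive; apply: filterS nK => y Ky; exact: pderiv_q.
have d1 := derivableP (Ck_derivable (i := i) (Ck_pderiv j fC) Kx).
have d2 : is_derive x (evec i) (fun y : 'cV[R]_d => c * y j 0) (c * (evec i : 'cV[R]_d) j 0).
  exact: is_deriveZ (is_derive_coord x (evec i) j).
have [_ ->] := is_deriveD d1 d2.
by rewrite !mxE eqxx andbT eq_sym.
Qed.

End Quadratic.
End Instances.

(** * Newton iteration *)

Section NewtonIteration.
Context {R : realType} {d : nat}.
Variables (K : set 'cV[R]_d) (M : R).
Hypothesis cK : convex_set K.
Hypothesis M_gt0 : 0 < M.
Variables (f : 'cV[R]_d -> R) (gf : 'cV[R]_d -> 'cV[R]_d) (A : 'cV[R]_d -> 'M[R]_d).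
Variable T : 'cV[R]_d -> 'cV[R]_d -> 'cV[R]_d -> 'cV[R]_d -> R.
Hypothesis fS : sc_function K M f gf A T.
Implicit Types (x y u v w z p s : 'cV[R]_d) (H : 'M[R]_d).

Definition hess_approx u H := posdef H /\ forall v,
  49 / 50 * qform (A u) v <= qform H v <= 51 / 50 * qform (A u) v.

(** The radius exceeds twice the refresh threshold [M^-1 / 41], so that the Newton iterates of a
    round starting within that threshold remain inside. *)
Definition trust_region u H x := lnorm H (x - u) <= M^-1 / 20.

Section TrustRegion.
Variables (u : 'cV[R]_d) (H : 'M[R]_d).
Hypotheses (Ku : interior K u) (uH : hess_approx u H).

Let Hp : posdef H := uH.1.

Lemma trust_regionP x : trust_region u H x ->
  interior K x /\ forall v, 3 / 4 * qform H v <= qform (A x) v <= 5 / 4 * qform H v.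
Proof.
rewrite /trust_region; have -> : x = u + (x - u) by rewrite addrC subrK.
move: (x - u) => p {x}; rewrite addrAC subrr add0r => pH.
have rH : lnorm (A u) p <= 51 / 50 * lnorm H p.
  apply: lnorm_le => [|v]; first by rewrite divr_ge0.
  have /andP[h _] := uH.2 v; have := posdef_ge0 v Hp.
  by move: (qform _ _) (qform _ _) h => a b h b0; lra.
have Mr : M * lnorm (A u) p <= 1 / 17.
  have := ler_wpM2l (ltW M_gt0) rH; have := ler_wpM2l (ltW M_gt0) pH.
  rewrite mulrA divff ?gt_eqF//.
  by move: (lnorm H p) (lnorm (A u) p) => a b; lra.
have Mr1 : M * lnorm (A u) p < 1 by lra.
split=> [|v]; first exact: (dikin_interior fS Ku).
have [h1 h2] := sc_stable fS v Ku Mr1.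
set lam := 8 / 3 * _ / _ in h1 h2.
(* [M r <= 1 / 17] gives [lam <= 8/3 / 16 = 1/6], and [expR (- lam) >= 5/6] gives [expR lam <= 6/5].
   Combined with the factors 49/50 and 51/50 of [hess_approx], this stays within 3/4 and 5/4. *)
have lam_le : lam <= 1 / 6.
  rewrite /lam ler_pdivrMr ?subr_gt0//.
  by move: (M * _) Mr => a; lra.
have e0 : 0 < expR lam := expR_gt0 lam.
have e65 : expR lam <= 6 / 5.
  have e1 := expR_ge1Dx (- lam).
  have eN : expR lam * expR (- lam) = 1 by rewrite -expRD subrr expR0.
  have l56 : 5 / 6 <= expR (- lam) by lra.
  by have := ler_wpM2l (ltW e0) l56; rewrite eN; lra.
have /andP[k1 k2] := uH.2 v.
have a0 := posdef_ge0 v (sc_posdef fS Ku).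
have b0 : 0 <= qform (A (u + p)) v.
  by apply: (sc_qform_ge0 fS); exact: (dikin_interior fS Ku).
have ea := ler_wpM2r a0 e65; have eb := ler_wpM2r b0 e65.
move: h1 h2 k1 k2 a0 b0 ea eb.
move: (expR _) (qform (A u) v) (qform (A (u + p)) v) (qform H v) => e a b c *.
by apply/andP; split; lra.
Qed.

(** 9/8 and 7/6 are rational upper bounds for the square roots of 5/4 and 4/3. *)
Lemma trust_region_lnorm x v : trust_region u H x ->
  lnorm (A x) v <= 9 / 8 * lnorm H v /\ lnorm H v <= 7 / 6 * lnorm (A x) v.
Proof.
move=> /trust_regionP[_ xH]; split; apply: lnorm_le => [|z]; rewrite ?divr_ge0//.
  have /andP[_ h] := xH z; have := posdef_ge0 z Hp.
  by move: (qform _ _) (qform _ _) h => a b h b0; lra.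
have /andP[h _] := xH z; have := posdef_ge0 z Hp.
by move: (qform _ _) (qform _ _) h => a b h b0; lra.
Qed.

Lemma trust_region_segment x y (c : R) : trust_region u H x -> trust_region u H y ->
  0 <= c <= 1 -> trust_region u H (x + c *: (y - x)).
Proof.
rewrite /trust_region => xH yH /andP[c0 c1].
have -> : x + c *: (y - x) - u = (1 - c) *: (x - u) + c *: (y - u).
  apply/matrixP => i j; rewrite !mxE; ring.
apply: le_trans (lnormD _ _ Hp) _; rewrite !lnormZ !ger0_norm ?subr_ge0//.
have s0 : 0 <= 1 - c by rewrite subr_ge0.
have := ler_wpM2l c0 yH; have := ler_wpM2l s0 xH.
by move: (M^-1 / 20) (lnorm _ _) (lnorm _ _) => a b e; lra.
Qed.

Lemma trust_region_mvt x y v : trust_region u H x -> trust_region u H y ->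
  exists2 z, trust_region u H z &
    dotv (gf y) v - dotv (gf x) v = bform (A z) (y - x) v.
Proof.
move=> xH yH; have [Kx _] := trust_regionP xH; have [Ky _] := trust_regionP yH.
have [z [_ [c c01 ->] E]] := grad_mvt cK fS v Kx Ky.
by exists (x + c *: (y - x)) => //; exact: trust_region_segment.
Qed.

(* Strong monotonicity bounds the distance between two points by their residuals
   alone, so the displacement does not grow with the number of Newton steps. *)
Lemma displacement_le s x y (a b : R) : trust_region u H x -> trust_region u H y ->
  0 <= a + b -> dual_le H (gf x + s) a -> dual_le H (gf y + s) b ->
  lnorm H (y - x) <= 4 / 3 * (a + b).
Proof.
move=> xH yH ab0 xa yb.
have [z zH E] := trust_region_mvt (y - x) xH yH.
have [_ zq] := trust_regionP zH; have /andP[h _] := zq (y - x).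
have le_ab : dotv (gf y) (y - x) - dotv (gf x) (y - x) <= (a + b) * lnorm H (y - x).
  have := dual_leD yb (dual_leN xa) (y - x).
  by rewrite opprD addrACA subrr addr0 dotvBl [b + a]addrC.
rewrite E in le_ab.
have := lnorm_ge0 H (y - x); rewrite le_eqVlt => /predU1P[<-|n0].
  by rewrite mulr_ge0// divr_ge0.
rewrite -sqr_lnorm// expr2 in h.
have : 3 / 4 * lnorm H (y - x) * lnorm H (y - x) <= (a + b) * lnorm H (y - x).
  by rewrite -mulrA; exact: le_trans h le_ab.
by rewrite ler_pM2r//; move: (lnorm _ _) => c; lra.
Qed.

Section Step.
Variables (s gh w : 'cV[R]_d) (eps a : R).
Hypotheses (eps0 : 0 <= eps) (a0 : 0 <= a).
Hypothesis wH : trust_region u H w.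
Hypothesis wa : dual_le H (gf w + s) a.
Hypothesis ghP : dual_le (A w) (gh - gf w) eps.

Let w' := w - invmx H *m (gh + s).

Let errH : dual_le H (gh - gf w) (9 / 8 * eps).
Proof.
by apply: dual_le_mx ghP => // v; exact: (trust_region_lnorm v wH).1.
Qed.

Let gradH : dual_le H (gh + s) (a + 9 / 8 * eps).
Proof.
have -> : gh + s = (gf w + s) + (gh - gf w) by apply/matrixP => i j; rewrite !mxE; ring.
exact: dual_leD.
Qed.

Lemma newton_step_size : lnorm H (w' - w) <= a + 9 / 8 * eps.
Proof.
rewrite /w' addrAC subrr add0r lnormN; apply: lnorm_invmx_le => //.
by rewrite addr_ge0// mulr_ge0// divr_ge0.
Qed.

(** As [H (w' - w) = - (gh + s)], the new residual is [(A z - H) (w' - w)] minus the oracle error,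
    and [A z - H] has relative size at most 1/4. The mean value point [z] depends on the test vector
    [v], which is harmless since [dual_le] treats one [v] at a time. *)
Lemma newton_step_residual : trust_region u H w' ->
  dual_le H (gf w' + s) (9 / 8 * eps + 1 / 4 * (a + 9 / 8 * eps)).
Proof.
move=> w'H v.
have [z zH E] := trust_region_mvt v wH w'H.
have Ew : w' - w = - (invmx H *m (gh + s)) by rewrite /w' addrAC subrr add0r.
have bH : dotv (gh + s) v = - bform H (w' - w) v.
  rewrite Ew bformNl opprK (bformC _ _ Hp.1) /bform mulmx_invmx//.
  exact: dotvC.
have -> : dotv (gf w' + s) v = bform (A z - H) (w' - w) v - dotv (gh - gf w) v.
  rewrite -scaleN1r bform_mx mulN1r -bH -E !dotvDl dotvNl; ring.
have [_ zq] := trust_regionP zH.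
have sym : (A z - H)^T = A z - H.
  by rewrite linearB /= Hp.1 (sc_sym fS)//; exact: (trust_regionP zH).1.
have EH w0 : `|qform (A z - H) w0| <= 1 / 4 * qform H w0.
  have := zq w0; rewrite qformB ler_norml.
  by move: (qform _ _) (qform _ _) => b1 b2 /andP[? ?]; apply/andP; split; lra.
have h1 := bform_le (w' - w) v sym Hp EH.
have h2 := dual_le_norm v errH.
have N0 := lnorm_ge0 H v.
have h3 := ler_wpM2r N0 newton_step_size.
have := ler_norm (bform (A z - H) (w' - w) v).
have := ler_norm (- dotv (gh - gf w) v); rewrite normrN.
move: h1 h2 h3; move: (bform _ _ _) (dotv _ _) => b1 b2.
by move: (lnorm H (w' - w)) (lnorm H v) => n1 n2; lra.
Qed.

End Step.

End TrustRegion.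

Lemma newton_cost (O : grad_oracle R d) n Hinv s w :
  (newton O n Hinv s w).2 = (n * (call_cost O + (d + (2 * d ^ 2 + d))))%N.
Proof. by elim: n w => [//|n IH] w; rewrite [LHS]/= IH mulSn. Qed.

Lemma newton_converges (O : grad_oracle R d) u H s w0 (eps a0 : R) n :
  interior K u -> hess_approx u H -> 0 <= eps -> 0 <= a0 ->
  (forall w, interior K w -> dual_le (A w) (answer O w - gf w) eps) ->
  lnorm H (w0 - u) <= M^-1 / 41 -> eps <= M^-1 / 2000 -> a0 <= M^-1 / 250 ->
  dual_le H (gf w0 + s) a0 ->
  let w := (newton O n (invmx H) s w0).1 in
  trust_region u H w /\ dual_le H (gf w + s) (4^-1 ^+ n * a0 + 9 / 4 * eps).
Proof.
move=> Ku uH eps0 a00 OP w0u epsM a0M w0a /=.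
have Hp := uH.1; have Mi : 0 < M^-1 by rewrite invr_gt0.
have q0 k : 0 <= 4^-1 ^+ k :> R by rewrite exprn_ge0// invr_ge0.
have q1 k : 4^-1 ^+ k <= 1 :> R by rewrite exprn_ile1 ?invr_ge0 ?invf_le1 ?ler1n.
have w0H : trust_region u H w0.
  by apply: le_trans w0u _; move: Mi; move: (M^-1) => m; lra.
(* [k] counts the steps already done. The start [w0] stays fixed throughout: distances are measured
   from it by [displacement_le], not by adding up step lengths. *)
suff loop : forall k w, trust_region u H w ->
    dual_le H (gf w + s) (4^-1 ^+ k * a0 + 9 / 4 * eps) ->
    trust_region u H (newton O n (invmx H) s w).1 /\
    dual_le H (gf (newton O n (invmx H) s w).1 + s) (4^-1 ^+ (k + n) * a0 + 9 / 4 * eps).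
  have [||h1 h2] := loop 0%N w0 => //.
  by apply: dual_leW w0a; rewrite expr0 mul1r lerDl mulr_ge0// divr_ge0.
elim: n => [|n IH] k w wH wa; first by rewrite addn0.
have ak0 : 0 <= 4^-1 ^+ k * a0 + 9 / 4 * eps.
  by rewrite addr_ge0// mulr_ge0// divr_ge0.
have ak1 : 4^-1 ^+ k * a0 <= a0 by rewrite ler_piMl.
have ghP := OP w (trust_regionP Ku uH wH).1.
have sz := newton_step_size Ku uH eps0 ak0 wH wa ghP.
have dp := displacement_le Ku uH w0H wH (addr_ge0 a00 ak0) w0a wa.
pose w' := w - invmx H *m (answer O w + s).
have w'H : trust_region u H w'.
  rewrite /trust_region.
  have t1 := lnorm_trans w w' u Hp; have t2 := lnorm_trans w0 w u Hp.
  rewrite -/w' in sz.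
  move: (4^-1 ^+ k * a0) ak0 ak1 sz dp => b ak0 ak1 sz dp.
  move: (lnorm _ _) (lnorm _ _) (lnorm _ _) (lnorm _ _) (lnorm _ _) (M^-1) t1 t2 sz dp epsM a0M w0u Mi.
  by move=> n1 n2 n3 n4 n5 Mi *; lra.
have re := newton_step_residual Ku uH eps0 ak0 wH wa ghP w'H.
rewrite [newton _ _ _ _ _]/= -/w' addnS -addSn; apply: IH => //.
(* The recursion [r |-> 9/8 eps + (r + 9/8 eps) / 4] has the fixed point [15/8 eps], below the
   stated [9/4 eps]. *)
apply: dual_leW re; rewrite exprS -[4^-1 * _ * a0]mulrA.
by move: (4^-1 ^+ k * a0) => b; lra.
Qed.

End NewtonIteration.

(** * The run of the algorithm *)

Section Run.
Context {R : realType} {d : nat}.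
Variables (K : set 'cV[R]_d) (M : R).
Hypothesis cK : convex_set K.
Hypothesis M_gt0 : 0 < M.
Variables (f : 'cV[R]_d -> R) (gf : 'cV[R]_d -> 'cV[R]_d) (A : 'cV[R]_d -> 'M[R]_d).
Variable T : 'cV[R]_d -> 'cV[R]_d -> 'cV[R]_d -> 'cV[R]_d -> R.
Hypothesis fS : sc_function K M f gf A T.
Variables (Ograd : grad_oracle R d) (Ohess : hess_oracle R d).
Variables (eta eps a : R) (mN : nat) (wstar : 'cV[R]_d).
Hypothesis OgradP : forall w, interior K w -> dual_le (A w) (answer Ograd w - gf w) eps.
Hypothesis OhessP : forall u, interior K u ->
  hess_approx A u (answer Ohess u).1 /\ (answer Ohess u).2 = invmx (answer Ohess u).1.
Hypotheses (eps0 : 0 <= eps) (epsM : eps <= M^-1 / 2000).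
Hypotheses (aM : a <= M^-1 / 1000) (epsa : eps <= a).
Hypothesis rate : 4^-1 ^+ mN.-1 <= M * eps.

Let Mi : 0 < M^-1. Proof. by rewrite invr_gt0. Qed.
Let a_ge0 : 0 <= a. Proof. exact: le_trans epsa. Qed.

Definition residual (st : @state R d) := gf (st_w st) + st_s st.

(** The invariant between rounds. Its residual bound refers to the Hessian at [st_w] and not to
    [st_H], so it survives a refresh of the matrix. *)
Record admissible (st : @state R d) : Prop := Admissible {
  adm_u : interior K (st_u st);
  adm_H : hess_approx A (st_u st) (st_H st);
  adm_Hinv : st_Hinv st = invmx (st_H st);
  adm_w : lnorm (st_H st) (st_w st - st_u st) <= M^-1 / 41;
  adm_residual : dual_le (A (st_w st)) (residual st) (4 * eps) }.

Lemma adm_trust_region st : admissible st -> trust_region M (st_u st) (st_H st) (st_w st).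
Proof.
by move=> /adm_w h; apply: le_trans h _; move: Mi; move: (M^-1) => m; lra.
Qed.

Lemma adm_interior st : admissible st -> interior K (st_w st).
Proof.
move=> Ast; have w_in := adm_trust_region Ast.
by have [] := trust_regionP M_gt0 fS (adm_u Ast) (adm_H Ast) w_in.
Qed.

Definition round_cost : nat :=
  (d + d + mN.-1 * (call_cost Ograd + (d + (2 * d ^ 2 + d))) + d
   + (2 * d ^ 2 + 2 * d + 1) + 1)%N.

Lemma round_admissible st gt : admissible st ->
  (forall w, interior K w -> dual_le (A w) (eta *: gt) a) ->
  let r := barons_round Ograd Ohess M eta mN st gt in
  [/\ admissible r.1, st_s r.1 = st_s st + eta *: gt,
    bregman f gf (st_w st) (st_w r.1)
      + dotv (residual r.1) (st_w st - st_w r.1) <= 180 * a ^+ 2 &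
    exists2 b : bool, (r.2 <= round_cost + b * call_cost Ohess)%N &
      b%:R * (M^-1 / 41) + lnorm (st_H r.1) (st_w r.1 - st_u r.1)
        <= lnorm (st_H st) (st_w st - st_u st) + 11 * a].
Proof.
move=> Ast gP /=.
have w_in := adm_trust_region Ast; have Kw := adm_interior Ast.
have [Ku uH HinvE w_near eP] := Ast; have Hp := uH.1.
set s := st_s st + eta *: gt.
(* The old residual plus the new subgradient, converted from the local norm to that of [st_H]. *)
set a0 := 9 / 8 * (4 * eps + a).
have a00 : 0 <= a0 by rewrite /a0; move: eps0 a_ge0; lra.
have a0M : a0 <= M^-1 / 250.
  by rewrite /a0; move: epsM aM Mi; move: (M^-1) => m; lra.
have w_res : dual_le (st_H st) (gf (st_w st) + s) a0.
  apply: (@dual_le_mx _ _ (A (st_w st))).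
  - by move: eps0 a_ge0; lra.
  - by move=> v; have [] := trust_region_lnorm M_gt0 fS Ku uH v w_in.
  by rewrite /s addrA; apply: dual_leD => //; exact: gP.
have [] := newton_converges cK M_gt0 fS mN.-1 Ku uH eps0 a00 OgradP w_near epsM a0M w_res.
rewrite -HinvE; set w' := (newton _ _ _ _ _).1 => w'_in w'_res0.
(* [rate] shrinks the initial residual to [eps / 250]; added to [9/4 eps], it stays below
   [23/10 eps]. *)
have {w'_res0}w'_res : dual_le (st_H st) (gf w' + s) (23 / 10 * eps).
  apply: dual_leW w'_res0.
  have q0 : 0 <= 4^-1 ^+ mN.-1 :> R by rewrite exprn_ge0// invr_ge0.
  have : 4^-1 ^+ mN.-1 * a0 <= M * eps * (M^-1 / 250) by exact: ler_pM.
  have -> : M * eps * (M^-1 / 250) = eps / 250 by field; rewrite gt_eqF.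
  by move: (_ * a0) => b; move: eps0; lra.
have [Kw' w'_q] := trust_regionP M_gt0 fS Ku uH w'_in.
have w'_local : dual_le (A w') (gf w' + s) (4 * eps).
  apply: (@dual_leW _ _ _ _ (7 / 6 * (23 / 10 * eps))); first by move: eps0; lra.
  apply: dual_le_mx w'_res; first by move: eps0; lra.
  by move=> v; have [] := trust_region_lnorm M_gt0 fS Ku uH v w'_in.
(* With [eps <= a], the factor is 4/3 (9/8 * 5 + 23/10) < 11. *)
have move_le : lnorm (st_H st) (w' - st_w st) <= 11 * a.
  have ab0 : 0 <= a0 + 23 / 10 * eps by move: a00 eps0; lra.
  have := displacement_le cK M_gt0 fS Ku uH w_in w'_in ab0 w_res w'_res.
  by move=> h; apply: le_trans h _; rewrite /a0; move: eps0 epsa; lra.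
have breg_le : bregman f gf (st_w st) w' + dotv (gf w' + s) (st_w st - w') <= 180 * a ^+ 2.
  have n0 := lnorm_ge0 (st_H st) (w' - st_w st).
  have n2 : lnorm (st_H st) (w' - st_w st) ^+ 2 <= (11 * a) ^+ 2.
    by rewrite lerXn2r ?nnegrE// (le_trans n0).
  have h1 : bregman f gf (st_w st) w' <= 5 / 4 * (11 * a) ^+ 2.
    (* The divergences in both directions add up to the gradient difference paired with [w' - w], so
       dropping the nonnegative reverse one leaves at most [5/4 (11 a)^2]. Together with
       [23/10 * 11 a^2] from the residual, this stays below [180 a^2]. *)
    have := bregman_ge0 cK fS Kw Kw'.
    have [z z_in E] := trust_region_mvt cK M_gt0 fS Ku uH (w' - st_w st) w_in w'_in.
    have [_ zq] := trust_regionP M_gt0 fS Ku uH z_in.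
    have /andP[_] := zq (w' - st_w st); rewrite -(sqr_lnorm _ Hp) -[qform (A z) _]/(bform _ _ _) -E.
    rewrite /bregman -(opprB w' (st_w st)) dotvNr.
    move: n2; move: (f _) (f _) (dotv _ _) (dotv _ _) (_ ^+ 2) (_ ^+ 2) => b1 b2 b3 b4 b5 b6.
    by lra.
  have h2 : dotv (gf w' + s) (st_w st - w') <= 23 / 10 * eps * (11 * a).
    apply: le_trans (w'_res _) _; rewrite lnormBC ler_wpM2l//.
    by move: eps0; lra.
  have h3 : eps * a <= a ^+ 2 by rewrite expr2 ler_wpM2r.
  rewrite exprMn in h1; move: h1 h2 h3 (sqr_ge0 a); move: (bregman _ _ _ _) (dotv _ _) (a ^+ 2) => b1 b2 a2.
  have -> : 23 / 10 * eps * (11 * a) = 253 / 10 * (eps * a) by field.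
  by move: (eps * a) => c; lra.
have cost_ok (b : bool) c : (c = if b then call_cost Ohess else 0)%N ->
  (d + (d + ((newton Ograd mN.-1 (st_Hinv st) s (st_w st)).2
    + (d + (2 * d ^ 2 + 2 * d + 1 + (1 + c))))) <= round_cost + b * call_cost Ohess)%N.
  by move=> ->; rewrite newton_cost /round_cost !addnA; case: b; rewrite ?mul1n ?mul0n.
rewrite -lnorm_mxnorm.
have ME : 1 / (41 * M) = M^-1 / 41 by rewrite mul1r invfM mulrC.
rewrite ME; have [near|far] := leP (lnorm (st_H st) (w' - st_u st)) (M^-1 / 41).
- split => //=; exists false; first exact: (cost_ok false 0%N).
  rewrite mul0r add0r; apply: le_trans (lnorm_trans (st_w st) _ _ Hp) _.
  by rewrite addrC lerD2l.
- have [w'H w'Hinv] := OhessP Kw'.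
  split => //=.
  + split => //=; rewrite subrr lnorm0; apply: ltW; exact: divr_gt0.
  + exists true; first by apply: (cost_ok true); rewrite addn0.
    rewrite mul1r subrr lnorm0 addr0; apply: le_trans (ltW far) _.
    by apply: le_trans (lnorm_trans (st_w st) _ _ Hp) _; rewrite addrC lerD2l.
Qed.

Hypothesis Kstar : interior K wstar.
Hypothesis gstar : gf wstar = 0.

Lemma init_admissible : admissible (barons_init Ohess wstar).1.
Proof.
have [H1 H2] := OhessP Kstar; split => //=.
  by rewrite subrr lnorm0; apply: ltW; exact: divr_gt0.
rewrite /residual /= gstar addr0 => v; rewrite -(scale0r (0 : 'cV[R]_d)) dotvZl mul0r.
by rewrite !mulr_ge0 ?lnorm_ge0.
Qed.

(* The three-point identity of mirror descent; [gf w + s] is the residual at [w]. *)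
Lemma regret_step w w' s s' v :
  dotv (s' - s) (w - v) = bregman f gf v w - bregman f gf v w'
    + (bregman f gf w w' + dotv (gf w' + s') (w - w'))
    + dotv (gf w' + s') (w' - v) - dotv (gf w + s) (w - v).
Proof. by rewrite /bregman !(dotvDl, dotvNl, dotvDr, dotvNr); ring. Qed.

(* [k] counts the Hessian updates: each one resets the distance to [st_u] to 0
   after it has exceeded [M^-1 / 41]. *)
Lemma barons_run (g : nat -> 'cV[R]_d) n :
  (forall t, (t < n)%N -> forall w, interior K w -> dual_le (A w) (eta *: g t) a) ->
  let run := barons Ograd Ohess M eta mN wstar g in
  [/\ admissible (run n).1,
    exists2 k : nat,
      ((run n).2 <= call_cost Ohess + n * round_cost + k * call_cost Ohess)%N &
      k%:R * (M^-1 / 41) + lnorm (st_H (run n).1) (st_w (run n).1 - st_u (run n).1)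
        <= n%:R * (11 * a) &
    forall v, interior K v ->
      \sum_(t < n) dotv (eta *: g t) (st_w (run t).1 - v) <=
        bregman f gf v wstar - bregman f gf v (st_w (run n).1)
        + dotv (residual (run n).1) (st_w (run n).1 - v) + n%:R * (180 * a ^+ 2)].
Proof.
elim: n => [|n IH] gP run.
  split; first exact: init_admissible.
  - exists 0%N; first by rewrite /= mul0n !addn0.
    by rewrite !mul0r add0r /= subrr lnorm0.
  - move=> v Kv; rewrite big_ord0 mul0r addr0 /= subrr add0r /residual /= gstar addr0.
    by rewrite -(scale0r (0 : 'cV[R]_d)) dotvZl mul0r.
have [|An [k cost_k move_k] reg] := IH; first by move=> t tn; apply: gP; exact: ltnW.
have [An1 sE breg_le [b cost_b move_b]] := round_admissible An (gP n (ltnSn n)).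
have E1 : (run n.+1).1 = (barons_round Ograd Ohess M eta mN (run n).1 (g n)).1 by [].
have E2 : (run n.+1).2 =
  ((run n).2 + (barons_round Ograd Ohess M eta mN (run n).1 (g n)).2)%N by [].
rewrite E1 E2 {E1 E2}; rewrite -/run in cost_k move_k reg An1 sE breg_le cost_b move_b.
move: (barons_round _ _ _ _ _ _ _) An1 sE breg_le cost_b move_b => r An1 sE breg_le cost_b move_b.
have nS : n.+1%:R = n%:R + 1 :> R by rewrite natr1.
split => //.
- have cost_kb : ((run n).2 + r.2 <= call_cost Ohess + n.+1 * round_cost
      + (k + b) * call_cost Ohess)%N.
    rewrite mulnDl mulSn; apply: leq_trans (leq_add cost_k cost_b) _.
    have : forall p q r s t : nat, (s + p + q + (t + r) <= s + (t + p) + (q + r))%N.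
      by clear; move=> *; lia.
    exact.
  exists (k + b)%N => //.
  rewrite natrD mulrDl nS [(_ + 1) * _]mulrDl mul1r.
  by move: move_k move_b; move: (k%:R * _) (b%:R * _) (n%:R * _) (lnorm _ _) (lnorm _ _) => *; lra.
- move=> v Kv; rewrite big_ord_recr /=.
  have := reg v Kv; have -> : eta *: g n = st_s r.1 - st_s (run n).1.
    by rewrite sE addrAC subrr add0r.
  rewrite (regret_step (st_w (run n).1) (st_w r.1)) -/(residual _) -/(residual _).
  rewrite nS [(_ + 1) * _]mulrDl mul1r; move: breg_le.
  rewrite -/(residual r.1).
  move: (\sum_(t < n) dotv (eta *: g t) _) (n%:R * (180 * a ^+ 2)) (180 * a ^+ 2) => S N1 N2.
  move: (dotv (residual (run n).1) _) (dotv (residual r.1) (_ - v)) (dotv _ _) => e1 e2 e3.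
  move: (bregman f gf v wstar) (bregman f gf v (st_w (run n).1)) (bregman f gf v (st_w r.1)).
  by move: (bregman _ _ _ _) => *; lra.
Qed.

(** The final residual, of size [4 eps], is absorbed by the final divergence through
    [bregman_dual_le], at the price [2 (4 eps)^2 = 32 eps^2]. The gradient vanishes at [wstar], so
    the initial divergence is just [f v - f wstar]. *)
Lemma barons_regret (g : nat -> 'cV[R]_d) n v :
  (forall t, (t < n)%N -> forall w, interior K w -> dual_le (A w) (eta *: g t) a) ->
  interior K v ->
  \sum_(t < n) dotv (eta *: g t) (barons_iterate Ograd Ohess M eta mN wstar g t - v)
    <= f v - f wstar + 32 * eps ^+ 2 + n%:R * (180 * a ^+ 2).
Proof.
move=> gP Kv; have [An _ /(_ v Kv)] := barons_run gP.
have e40 : 0 <= 4 * eps by rewrite mulr_ge0.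
have e4M : 8 * M * (4 * eps) <= 1.
  have := ler_wpM2l (ltW M_gt0) epsM.
  have -> : M * (M^-1 / 2000) = 2000^-1 by rewrite mulrA divff ?gt_eqF// mul1r.
  by move: (M_gt0) eps0; move: eps => e; lra.
have := bregman_dual_le cK fS M_gt0 (adm_interior An) Kv e40 e4M.
have := dual_le_norm (v - st_w (barons Ograd Ohess M eta mN wstar g n).1) (adm_residual An).
rewrite -normrN -dotvNr opprB => h1; have {h1} := le_trans (ler_norm _) h1.
have -> : bregman f gf v wstar = f v - f wstar.
  by rewrite /bregman gstar -(scale0r (0 : 'cV[R]_d)) dotvZl mul0r subr0.
rewrite /barons_iterate exprMn.
move: (\sum_(_ < _) _) (dotv _ _) (4 * eps * _) (bregman _ _ _ _) (n%:R * _) (eps ^+ 2) => *.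
by lra.
Qed.

End Run.

(** * Numerical estimates *)

Section Numerics.
Context {R : realType}.
Implicit Types (M nu tau l a eps : R).

(** [e <= 4], because [expR (- 1/2) >= 1/2]. *)
Lemma ln_ge1 (y : R) : 4 <= y -> 1 <= ln y.
Proof.
move=> y4; have y0 : 0 < y by lra.
rewrite -[leLHS]expRK ler_ln ?posrE ?expR_gt0//; apply: le_trans y4.
have h := expR_ge1Dx (- (2^-1) : R).
have E : expR 1 * expR (- (2^-1)) * expR (- (2^-1)) = 1 :> R.
  by rewrite -!expRD (_ : 1 - 2^-1 - 2^-1 = 0 :> R) ?expR0//; field.
have e0 := expR_gt0 (1 : R).
move: h E e0; move: (expR _) (expR _) => x e h E e0.
have h2 : 4^-1 <= e * e.
  have -> : 4^-1 = 2^-1 * 2^-1 :> R by field.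
  by apply: ler_pM; lra.
by have := ler_wpM2l (ltW e0) h2; rewrite mulrA E; lra.
Qed.

Lemma eps_bounds M eps : 0 < M -> 0 < eps -> eps <= 1 / (20000 * M) ->
  eps <= M^-1 / 2000 /\ eps * M <= 1 / 4.
Proof.
move=> M0 e0; rewrite div1r invfM [_ * M^-1]mulrC => eM.
have Mi : 0 < M^-1 by rewrite invr_gt0.
have eM2 : eps <= M^-1 / 2000 by move: (M^-1) Mi eM => m; clear; lra.
split=> //; have := ler_wpM2r (ltW M0) eM2.
by rewrite mulrAC mulVf ?gt_eqF//; move: (eps * M) => x; clear; lra.
Qed.

Lemma alpha_bounds : 0 <= (1 / 1000 : R) <= 1 / 50.
Proof. by apply/andP; split; lra. Qed.

(** The factor 2 pays for the one step lost in [m.-1]: the logarithm [L] is at least 1, so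
    [2 L - 1 >= L], and [1/4 <= 1/e]. *)
Lemma newton_rate (m : nat) M eps : 0 < M -> 0 < eps -> eps * M <= 1 / 4 ->
  2 * ln (1 / (eps * M)) <= m%:R -> 4^-1 ^+ m.-1 <= M * eps.
Proof.
move=> M0 e0 eM mL; have eM0 : 0 < eps * M by rewrite mulr_gt0.
have L1 : 1 <= ln (1 / (eps * M)).
  by apply: ln_ge1; rewrite ler_pdivlMr//; lra.
have mE : m%:R <= m.-1%:R + 1 :> R by rewrite natr1 ler_nat leqSpred.
have q1 : 4^-1 <= expR (-1) :> R.
  rewrite expRN lef_pV2 ?posrE ?expR_gt0//.
  by rewrite -[leRHS]lnK ?posrE// ler_expR ln_ge1.
apply: le_trans (_ : expR (-1) ^+ m.-1 <= _).
  by apply: lerXn2r; rewrite ?nnegrE ?expR_ge0 ?invr_ge0.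
have -> : M * eps = expR (- ln (1 / (eps * M))).
  by rewrite expRN lnK ?posrE ?divr_gt0// div1r invrK mulrC.
rewrite -expRM_natl mulrN1 ler_expR lerN2; lra.
Qed.

(** The bound is at most [213 nu (l + 1)], where 213 covers 1 + 32 + 180. Dividing by the step size
    leaves [213 Rad G S tau], and [S tau <= 2 sqrt (tau l)] since [l >= 1]. *)
Lemma regret_numeric (nu Rad G tau l a eps X : R) (S := Num.sqrt ((l + 1) / tau)) :
  0 < nu -> 0 < Rad -> 0 < G -> 1 <= tau -> 1 <= l ->
  eps ^+ 2 = nu / tau -> a = Num.sqrt nu * S ->
  nu / (Rad * G) * S * X <= nu * l + nu / 2 + 32 * eps ^+ 2 + tau * (180 * a ^+ 2) ->
  X <= 426 * (Rad * G * Num.sqrt (tau * l)).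
Proof.
move=> nu0 Rad0 G0 tau1 l1 eps2 aE.
have tau0 : 0 < tau by lra.
have l10 : 0 < l + 1 by lra.
have S0 : 0 < S by rewrite sqrtr_gt0 divr_gt0.
have S2 : S ^+ 2 * tau = l + 1.
  by rewrite sqr_sqrtr ?divr_ge0 ?(ltW l10) ?(ltW tau0)// divfK// gt_eqF.
have -> : tau * (180 * a ^+ 2) = 180 * (nu * (l + 1)).
  by rewrite aE exprMn sqr_sqrtr ?(ltW nu0)// -S2; ring.
have {}eps2 : eps ^+ 2 <= nu.
  by rewrite eps2 ler_pdivrMr// ler_peMr// ltW.
have Q : S * tau <= 2 * Num.sqrt (tau * l).
  rewrite -(@ler_pXn2r _ 2)// ?nnegrE ?mulr_ge0 ?sqrtr_ge0 ?(ltW S0) ?(ltW tau0)//.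
  have tl0 : 0 <= tau * l by rewrite mulr_ge0//; lra.
  rewrite !exprMn (sqr_sqrtr tl0).
  rewrite [tau ^+ 2]expr2 mulrA S2.
  by have := ler_wpM2r (ltW tau0) l1; lra.
move=> H; have c0 : 0 < nu / (Rad * G) * S by rewrite !mulr_gt0// invr_gt0 mulr_gt0.
have {}H : nu / (Rad * G) * S * X <= nu / (Rad * G) * S * (213 * (Rad * G * (S * tau))).
  apply: le_trans H _.
  have -> : nu / (Rad * G) * S * (213 * (Rad * G * (S * tau))) = 213 * (nu * (S ^+ 2 * tau)).
    by field; rewrite !gt_eqF.
  rewrite S2; have nl : nu <= nu * l by rewrite ler_peMr// ltW.
  by rewrite mulrDr mulr1; move: (nu * l) nl eps2 => b; lra.
rewrite ler_pM2l// in H; apply: le_trans H _.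
have RG0 : 0 <= Rad * G by rewrite mulr_ge0 ?ltW.
by have := ler_wpM2l RG0 Q; lra.
Qed.

(** The displacement budget gives [k <= 41 * 11 M tau a <= 902 X]; the initial Hessian call makes it
    903, using [X >= 1]. The extra [d] operations of each Hessian call go into the gradient term,
    because [k <= tau]. *)
Lemma cost_numeric (cost chP cgP n d cg ch k : R) (c2 M nu tau l a L Lg : R) :
  0 < M -> 0 < nu -> 1 <= Num.sqrt nu * M -> 1 <= tau -> 1 <= l -> 1 <= L -> L <= Lg ->
  0 <= n -> n <= c2 * L -> 1 <= c2 -> 1 <= d -> 0 <= cg -> 0 <= ch -> 0 <= k ->
  chP <= ch + d -> cgP <= cg + d ->
  a = Num.sqrt nu * Num.sqrt ((l + 1) / tau) -> a <= M^-1 / 1000 ->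
  k * (M^-1 / 41) <= tau * (11 * a) ->
  cost <= chP + tau * (d + d + n * (cgP + (d + (2 * d ^+ 2 + d))) + d
     + (2 * d ^+ 2 + 2 * d + 1) + 1) + k * chP ->
  cost <= (903 + 5 * c2) *
    ((cg + d ^+ 2) * tau * Lg + ch * M * Num.sqrt (tau * nu * l)).
Proof.
move=> M0 nu0 nuM tau1 l1 L1 LLg n0 nL c21 d1 cg0 ch0 k0 chPd cgPd aE aM ka H.
have tau0 : 0 < tau by lra.
have sn0 : 0 <= Num.sqrt nu := sqrtr_ge0 _.
set X := M * Num.sqrt (tau * nu * l).
have XE : X = Num.sqrt nu * M * Num.sqrt (tau * l).
  rewrite /X (_ : tau * nu * l = nu * (tau * l)); last by ring.
  by rewrite sqrtrM ?(ltW nu0)// mulrA [M * _]mulrC.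
have tl1 : 1 <= tau * l by rewrite -[leLHS]mulr1; apply: ler_pM.
have X1 : 1 <= X.
  rewrite XE -[leLHS]mulr1; apply: ler_pM => //.
  by rewrite -[leLHS]sqrtr1 ler_wsqrtr.
have kX : k <= 902 * X.
  have Q : Num.sqrt ((l + 1) / tau) * tau <= 2 * Num.sqrt (tau * l).
    rewrite -(@ler_pXn2r _ 2)// ?nnegrE ?mulr_ge0 ?sqrtr_ge0 ?(ltW tau0)//.
    rewrite !exprMn !sqr_sqrtr ?divr_ge0 ?mulr_ge0 ?(ltW tau0)//; [|lra|lra].
    have -> : (l + 1) / tau * tau ^+ 2 = (l + 1) * tau by field; rewrite gt_eqF.
    by have := ler_wpM2r (ltW tau0) l1; rewrite expr2; lra.
  have kM : k <= 451 * (M * (tau * a)).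
    have := ler_wpM2l (ltW M0) ka.
    have -> : M * (k * (M^-1 / 41)) = k / 41 by field; rewrite gt_eqF.
    by move: (tau) (a) => b c; lra.
  apply: le_trans kM _; rewrite aE XE.
  have nM0 : 0 <= Num.sqrt nu * M by lra.
  by have := ler_wpM2l nM0 Q; lra.
have c20 : 0 <= c2 := le_trans ler01 c21.
have d0 : 0 <= d := le_trans ler01 d1.
have L0 : 0 <= L := le_trans ler01 L1.
have X0 : 0 <= X := le_trans ler01 X1.
have kT : k <= tau.
  have := ler_wpM2l (ltW M0) ka.
  have -> : M * (k * (M^-1 / 41)) = k / 41 by field; rewrite gt_eqF.
  have Ma : M * (tau * (11 * a)) <= tau * 11 / 1000.
    have t11 : 0 <= tau * 11 * M by rewrite !mulr_ge0 ?ltW.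
    have := ler_wpM2l t11 aM.
    have -> : tau * 11 * M * (M^-1 / 1000) = tau * 11 / 1000.
      by rewrite mulrA mulfK// gt_eqF.
    by clear; lra.
  by move: (M * _) Ma => b; clear -tau0; lra.
have d2 : d <= d ^+ 2 by rewrite expr2 ler_peMr.
have Lg1 : 1 <= Lg := le_trans L1 LLg.
set Y := (cg + d ^+ 2) * tau * Lg.
have cgd : 0 <= cg + d ^+ 2 by rewrite addr_ge0 ?sqr_ge0.
have Y0 : 0 <= Y by rewrite /Y !mulr_ge0 ?(ltW tau0)// (le_trans ler01).
have B1 : n * (cgP + (d + (2 * d ^+ 2 + d))) <= 5 * c2 * ((cg + d ^+ 2) * L).
  apply: le_trans (_ : c2 * L * (5 * (cg + d ^+ 2)) <= _); last by clear; lra.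
  apply: le_trans (_ : n * (5 * (cg + d ^+ 2)) <= _).
    by apply: ler_wpM2l => //; clear -cgPd d2 cg0; lra.
  by apply: ler_wpM2r => //; rewrite mulr_ge0.
have B2 : d + d + n * (cgP + (d + (2 * d ^+ 2 + d))) + d + (2 * d ^+ 2 + 2 * d + 1) + 1
    <= (9 + 5 * c2) * ((cg + d ^+ 2) * L).
  have : d ^+ 2 <= (cg + d ^+ 2) * L.
    by rewrite -[leLHS]mulr1; apply: ler_pM; rewrite ?sqr_ge0// lerDr.
  by move: ((cg + d ^+ 2) * L) B1; move: (n * _) => b1 b2; clear -d1 d2; lra.
have B3 : tau * (d + d + n * (cgP + (d + (2 * d ^+ 2 + d))) + d
     + (2 * d ^+ 2 + 2 * d + 1) + 1) <= (9 + 5 * c2) * Y.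
  apply: le_trans (ler_wpM2l (ltW tau0) B2) _.
  have -> : tau * ((9 + 5 * c2) * ((cg + d ^+ 2) * L)) = (9 + 5 * c2) * ((cg + d ^+ 2) * tau) * L.
    ring.
  rewrite -mulrA; apply: ler_wpM2l; first by rewrite addr_ge0// mulr_ge0.
  by apply: ler_wpM2l => //; rewrite mulr_ge0 ?(ltW tau0).
have B4 : (1 + k) * d <= 2 * Y.
  apply: le_trans (_ : 2 * tau * d ^+ 2 <= _).
    apply: ler_pM => //; first by rewrite addr_ge0.
    by clear -tau1 kT; lra.
  rewrite -mulrA ler_wpM2l// /Y -[leLHS]mulr1; apply: ler_pM => //.
    by rewrite mulr_ge0 ?sqr_ge0 ?(ltW tau0).
  by rewrite mulrC ler_wpM2r ?(ltW tau0)// lerDr.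
have B5 : (1 + k) * ch <= 903 * (ch * X).
  by rewrite [(1 + k) * ch]mulrC mulrCA; apply: ler_wpM2l => //; clear -kX X1; lra.
have B6 : (1 + k) * chP <= (1 + k) * (ch + d).
  by apply: ler_wpM2l => //; rewrite addr_ge0.
have cX0 : 0 <= ch * X by rewrite mulr_ge0.
have C1 : 0 <= c2 * Y by rewrite mulr_ge0.
have C2 : 0 <= c2 * (ch * X) by rewrite mulr_ge0.
rewrite -[ch * M * _]mulrA -/X.
move: B3 B4 B5 B6 H C1 C2 cX0 Y0.
move: (tau * _) Y (ch * X) => b1 b2 b3; clear; lra.
Qed.

End Numerics.

(** * From oracles, minimiser and subgradients to the abstract hypotheses of the run *)

Section Instance.
Context {R : realType} {d : nat}.
Variables (K : set 'cV[R]_d) (M : R).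
Variables (f : 'cV[R]_d -> R) (gf : 'cV[R]_d -> 'cV[R]_d) (A : 'cV[R]_d -> 'M[R]_d).
Variable T : 'cV[R]_d -> 'cV[R]_d -> 'cV[R]_d -> 'cV[R]_d -> R.
Hypothesis fS : sc_function K M f gf A T.

(** Along the direction [gf x] itself, the derivative at the minimum is the squared length of
    [gf x]. *)
Lemma grad_argmin x : interior K x -> (forall w, interior K w -> f x <= f w) -> gf x = 0.
Proof.
move=> Kx fx; apply: dotv_eq0; set v := gf x.
have Kx0 : interior K (x + (0 : R) *: v) by rewrite scale0r addr0.
have [r r0 Kr] := open_line (@open_interior _ K) Kx0.
have Kt t : t \in `]- r, r[ -> interior K (x + t *: v).
  by rewrite in_itv /= => tr; apply: Kr; rewrite subr0 ltr_norml.
have fd t : t \in `]- r, r[ -> derivable (fun s : R => f (x + s *: v)) t 1.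
  by move=> /Kt Ks; have [] := sc_derive1 fS Ks.
have c0 : 0 \in `]- r, r[ by rewrite in_itv /= oppr_lt0 r0.
have rr : - r <= r by lra.
have [|_ E0] := derive1_at_min rr fd c0.
  by move=> t /Kt Ks; rewrite scale0r addr0; exact: fx.
have [_] := sc_derive1 fS Kx0; rewrite E0 scale0r addr0; exact: esym.
Qed.

Lemma hess_oracle_approx alpha F (O : hess_oracle R d) u : 0 <= alpha <= 1 / 50 ->
  is_hess_oracle K alpha F O -> (forall w, interior K w -> hess F w = A w) -> interior K u ->
  hess_approx A u (answer O u).1 /\ (answer O u).2 = invmx (answer O u).1.
Proof.
move=> /andP[al0 al] OF FA Ku; have [_ -> [[sym lo] [_ hi]] _] := OF u Ku.
split=> //; rewrite (FA u Ku) in lo hi sym.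
have Ap := sc_posdef fS Ku.
have bounds v : 49 / 50 * qform (A u) v <= qform (answer O u).1 v <= 51 / 50 * qform (A u) v.
  have := lo v; have := hi v; rewrite !qformB !qform_scale !subr_ge0.
  have q0 := posdef_ge0 v Ap; have := ler_wpM2r q0 al.
  by move: (qform _ _) (qform _ _) q0 => b c q0 ? ? ?; apply/andP; split; lra.
split=> //; split.
  (* The Loewner order includes symmetry of the difference, and [A u] is symmetric, so the oracle's
     matrix is symmetric too. *)
  move: sym; rewrite linearB /= linearZ /= Ap.1 => /eqP.
  by rewrite (inj_eq (addIr _)) => /eqP.
move=> v v0; have /andP[h _] := bounds v; apply: lt_le_trans h.
by apply: mulr_gt0; [lra|exact: Ap.2].
Qed.

Lemma grad_oracle_approx eps F (O : grad_oracle R d) w :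
  is_grad_oracle K eps F O -> (forall w, interior K w -> hess F w = A w) ->
  (forall w, interior K w -> grad F w = gf w) -> interior K w ->
  dual_le (A w) (answer O w - gf w) eps.
Proof.
move=> OF FA Fg Kw; apply: dual_le_invmx (sc_posdef fS Kw) _.
by rewrite lnorm_mxnorm -(FA w Kw) -(Fg w Kw); exact: OF.
Qed.

Lemma dual_le_enorm c G g w : 0 < c -> 0 <= G -> enorm g <= G -> interior K w ->
  (forall v, c ^+ 2 * dotv v v <= qform (A w) v) -> dual_le (A w) g (c^-1 * G).
Proof.
move=> c0 G0 gG Kw cA; apply: (@dual_le_mx _ _ 1%:M) => //.
  move=> v; apply: lnorm_le => [|u]; first by rewrite invr_ge0 ltW.
  by rewrite qform1 exprVn mulrC ler_pdivlMr ?exprn_gt0// mulrC.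
move=> v; have := cauchy_schwarz g v (@posdef1 R d).
rewrite /bform mul1mx => h; apply: le_trans (ler_norm _) _; apply: le_trans h _.
by rewrite ler_wpM2r ?lnorm_ge0// -enormE.
Qed.

End Instance.

(* c1, c2 are the constants of m_Newton = Theta(log (1 / (eps M))), and C is the
   constant of the two O-bounds: all are independent of the problem data. *)
Theorem theorem7 (R : realType) :
  exists2 c1 : R, 0 < c1 &
  forall c2 : R, c1 <= c2 ->
  exists2 C : R, 0 < C &
  forall (d : nat) (K : set 'cV[R]_d) (M nu Rad G : R)
    (Psi : 'cV[R]_d -> R)
    (Phi := fun x : 'cV[R]_d => Psi x + nu / (2 * Rad ^+ 2) * enorm x ^+ 2)
    (T : nat)
    (eta := nu / (Rad * G) * Num.sqrt ((ln T%:R + 1) / T%:R))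
    (eps := Num.sqrt (nu / T%:R))
    (alpha := 1 / 1000 : R)
    (mN : nat)
    (OgradPsi OgradPhi : grad_oracle R d)
    (OhessPsi OhessPhi : hess_oracle R d)
    (wstar : 'cV[R]_d)
    (l : nat -> 'cV[R]_d -> R) (g : nat -> 'cV[R]_d)
    (w_ := barons_iterate OgradPhi OhessPhi M eta mN wstar g),
  (0 < d)%N ->
  convex_set K -> compact K -> interior K !=set0 ->
  0 < M -> sc_barrier K M nu Psi ->
  0 < G -> 0 < Rad -> (forall x, K x -> enorm x <= Rad) ->
  (* oracles, and the cost of implementing those of Phi from those of Psi *)
  is_grad_oracle K eps Psi OgradPsi ->
  is_grad_oracle K eps Phi OgradPhi ->
  is_hess_oracle K alpha Psi OhessPsi ->
  is_hess_oracle K alpha Phi OhessPhi ->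
  (call_cost OgradPhi <= call_cost OgradPsi + d)%N ->
  (call_cost OhessPhi <= call_cost OhessPsi + d)%N ->
  (* wstar minimises Phi, which is +oo on the boundary of K *)
  interior K wstar -> (forall w, interior K w -> Phi wstar <= Phi w) ->
  (* the losses and subgradients of the T rounds *)
  (forall t, (t < T)%N -> convex_function K (l t)) ->
  (forall t, (t < T)%N -> subgradient K (l t) (w_ t) (g t)) ->
  (forall t, (t < T)%N -> enorm (g t) <= G) ->
  (* parameters *)
  c1 * ln (1 / (eps * M)) <= mN%:R <= c2 * ln (1 / (eps * M)) ->
  (1 <= T)%N ->
  eta <= 1 / (1000 * G * M) ->
  (* the same condition with G replaced by the bound Rad * G / sqrt nu on the
     dual local norms of the g t *)
  eta <= 1 / (1000 * (Rad * G / Num.sqrt nu) * M) ->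
  eps <= 1 / (20000 * M) ->
  [/\ forall t, (t < T)%N -> K (w_ t),
      forall w, interior K w ->
        \sum_(t < T) (l t (w_ t) - l t w)
          <= C * (Rad * G * Num.sqrt (T%:R * ln T%:R)) &
      nu <= T%:R ->
        (barons_cost OgradPhi OhessPhi M eta mN wstar g T)%:R
          <= C * (((call_cost OgradPsi)%:R + d%:R ^+ 2) * T%:R
                    * ln (T%:R / (nu * M))
                  + (call_cost OhessPsi)%:R * M
                    * Num.sqrt (T%:R * nu * ln T%:R))].
Proof.
exists 2 => // c2 c2_ge; exists (903 + 5 * c2); first by clear -c2_ge; lra.
move=> d K M nu Rad G Psi Phi T eta eps alpha mN OgP OgPhi OhP OhPhi wstar l g w_.
move=> d0 cK cptK [x0 Kx0] M0 [PsiS PsiB] G0 Rad0 KRad _ OgPhiP _ OhPhiP cgP chP.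
move=> Kstar Phistar lconv lsub gG mNE T1 _ etaE epsE.
have etaD : eta = nu / (Rad * G) * Num.sqrt ((ln T%:R + 1) / T%:R) by [].
have epsD : eps = Num.sqrt (nu / T%:R) by [].
have alphaD : 0 <= alpha <= 1 / 50 := alpha_bounds.
clearbody alpha eta eps.
have KT := bounded_exit KRad.
have KT' x u : interior K x -> u != 0 -> exists s : R, ~ interior K (x + s *: u).
  by move=> Kx u0; have [s _ Ks] := KT x u Kx u0; exists s.
have psiS := self_concordant_sc PsiS KT'.
have PsiC : Ck 3 (interior K) Psi by case: PsiS.
have sn0 : 0 <= Num.sqrt nu := sqrtr_ge0 _.
have psiB x : interior K x -> dual_le (hess Psi x) (grad Psi x) (Num.sqrt nu).
  move=> Kx; apply: dual_le_invmx (sc_posdef psiS Kx) _.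
  by rewrite lnormE; apply: ler_wsqrtr; exact: PsiB.
have nuM : 1 <= Num.sqrt nu * M.
  pose e0 : 'cV[R]_d := evec (Ordinal d0).
  have e0n : e0 != 0.
    apply/eqP => /matrixP/(_ (Ordinal d0) 0); rewrite !mxE !eqxx => /eqP.
    by rewrite oner_eq0.
  (* One orientation of a coordinate axis has a nonnegative slope. Its ray leaves the bounded [K] at
     a parameter [s >= 0], so rescaling by [s] keeps that sign. *)
  have [u u0 gu] : exists2 u : 'cV[R]_d, u != 0 & 0 <= dotv (grad Psi x0) u.
    have [ge|lt] := leP 0 (dotv (grad Psi x0) e0); first by exists e0.
    by exists (- e0); rewrite ?oppr_eq0// dotvNr oppr_ge0 ltW.
  have [s s0 Ks] := KT x0 u Kx0 u0.
  have sn : s *: u != 0.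
    by apply/eqP => su; apply: Ks; rewrite su addr0.
  apply: (barrier_parameter_ge1 psiS sn0 psiB Kx0 sn _ Ks).
  by rewrite dotvZr mulr_ge0.
have snp : 0 < Num.sqrt nu.
  rewrite lt_neqAle sn0 andbT eq_sym; apply: contraTneq nuM => ->.
  by rewrite mul0r -ltNge ltr01.
have nu0 : 0 < nu by rewrite -sqrtr_gt0.
have [tau tauE] : exists tau : R, T%:R = tau by exists T%:R.
have tau1 : 1 <= tau by rewrite -tauE ler1n.
rewrite tauE in etaD epsD *.
have tau0 : 0 < tau := lt_le_trans ltr01 tau1.
have epsp : 0 < eps by rewrite epsD sqrtr_gt0 divr_gt0.
have eps2 : eps ^+ 2 = nu / tau by rewrite epsD sqr_sqrtr// ltW// divr_gt0.
have [epsM2000 epsM4] := eps_bounds M0 epsp epsE.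
have eM0 : 0 < eps * M by rewrite mulr_gt0.
set L := ln (1 / (eps * M)) in mNE.
have L1 : 1 <= L by apply: ln_ge1; rewrite ler_pdivlMr//; clear -epsM4; lra.
have /andP[mN_ge mN_le] := mNE.
have rate := newton_rate M0 epsp epsM4 mN_ge.
(* [tau = nu / eps^2], with [sqrt nu * M >= 1] and [eps * M <= 1/4]. This makes [ln tau >= 1], so
   that constants can be absorbed into the logarithm. *)
have tau4 : 4 <= tau.
  have tE : tau = (Num.sqrt nu / eps) ^+ 2.
    by rewrite exprMn exprVn eps2 sqr_sqrtr ?(ltW nu0)// invf_div mulrCA divff ?gt_eqF// mulr1.
  have : 2 <= Num.sqrt nu / eps.
    rewrite ler_pdivlMr//.
    have : 2 * (eps * M) <= Num.sqrt nu * M by clear -epsM4 nuM; lra.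
    by rewrite mulrA ler_pM2r.
  rewrite tE; move: (_ / eps) => q; clear => q2.
  by rewrite expr2 (_ : 4 = 2 * 2 :> R); [apply: ler_pM|ring].
have l1 : 1 <= ln tau by exact: ln_ge1.
pose c := nu / Rad ^+ 2.
have c0 : 0 < c by rewrite divr_gt0// exprn_gt0.
have PhiE : Phi = (fun x => Psi x + c / 2 * dotv x x).
  apply/funext => x; rewrite /Phi /c /enorm sqr_sqrtr ?dotv_ge0//; congr (_ + _ * _).
  by rewrite invfM mulrA mulrAC.
clearbody Phi.
have phiS := sc_function_quadratic (ltW c0) psiS.
set gPhi := (fun x => grad Psi x + c *: x) in phiS.
set APhi := (fun x => hess Psi x + c *: 1%:M) in phiS.
have gPhiE w : interior K w -> grad Phi w = gPhi w.
  by move=> Kw; rewrite PhiE (grad_quadratic _ (CkW PsiC) Kw).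
have APhiE w : interior K w -> hess Phi w = APhi w.
  by move=> Kw; rewrite PhiE (hess_quadratic _ (CkW PsiC) Kw).
have OgradP w : interior K w -> dual_le (APhi w) (answer OgPhi w - gPhi w) eps.
  exact: (grad_oracle_approx phiS OgPhiP APhiE gPhiE).
have OhessP u : interior K u ->
    hess_approx APhi u (answer OhPhi u).1 /\ (answer OhPhi u).2 = invmx (answer OhPhi u).1.
  exact: (hess_oracle_approx phiS alphaD OhPhiP APhiE).
pose S := Num.sqrt ((ln tau + 1) / tau).
have S0 : 0 < S by rewrite sqrtr_gt0 divr_gt0// ltr_wpDl// (le_trans ler01).
pose a := Num.sqrt nu * S.
rewrite -/S in etaD.
have eta0 : 0 < eta by rewrite etaD mulr_gt0 ?divr_gt0 ?mulr_gt0.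
have etaa : eta * (Rad * G / Num.sqrt nu) = a.
  rewrite etaD /a -{1}(sqr_sqrtr (ltW nu0)).
  by field; rewrite !gt_eqF.
have gP t : (t < T)%N -> forall w, interior K w -> dual_le (APhi w) (eta *: g t) a.
  move=> tT w Kw; have qv v := sc_qform_ge0 psiS v Kw.
  rewrite -etaa; apply: dual_leZ; first exact: ltW.
  have -> : Rad * G / Num.sqrt nu = (Num.sqrt nu / Rad)^-1 * G.
    by rewrite invf_div mulrAC.
  apply: dual_le_enorm (gG t tT) Kw _; [by rewrite divr_gt0|exact: ltW|move=> v].
  rewrite exprMn exprVn sqr_sqrtr ?(ltW nu0)// -/c /APhi qform_mx qform1 lerDr.
  exact: qv.
(* This is the condition on [eta] multiplied by [Rad * G / sqrt nu]. *)
have aM : a <= M^-1 / 1000.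
  have RG0 : 0 < Rad * G / Num.sqrt nu by rewrite divr_gt0 ?mulr_gt0.
  rewrite -etaa -ler_pdivlMr//; move: etaE RG0; move: (Rad * G / _) => q etaq q0.
  have <- : 1 / (1000 * q * M) = M^-1 / 1000 / q by field; rewrite !gt_eqF.
  exact: etaq.
have epsa : eps <= a.
  rewrite epsD /a /S -sqrtrM ?(ltW nu0)//; apply: ler_wsqrtr; rewrite ler_pM2l//.
  by rewrite -[leLHS]mul1r ler_wpM2r ?invr_ge0 ?(ltW tau0)// lerDr (le_trans ler01).
have gstar : gPhi wstar = 0.
  by apply: (grad_argmin phiS Kstar) => w Kw; have := Phistar w Kw; rewrite PhiE.
have run n (nT : (n <= T)%N) := barons_run cK M0 phiS OgradP OhessP (ltW epsp) epsM2000 aM epsa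
  rate Kstar gstar (fun t (tn : (t < n)%N) => gP t (leq_trans tn nT)).
have w_in t : (t < T)%N -> interior K (w_ t).
  by move=> tT; have [At _ _] := run t (ltnW tT); exact: (adm_interior M0 phiS At).
split.
- by move=> t tT; exact: interior_subset (w_in t tT).
- move=> w Kw.
  pose v := wstar + (1 - tau^-1) *: (w - wstar).
  have ti0 : 0 < tau^-1 by rewrite invr_gt0.
  have ti1 : tau^-1 <= 1 by rewrite invf_le1.
  have s01 : 0 <= 1 - tau^-1 < 1 by rewrite subr_ge0 ti1 ltrBlDr ltrDl.
  have Kv : interior K v by exact: (interior_segment cK Kstar (interior_subset Kw) s01).
  have reg := barons_regret cK M0 phiS OgradP OhessP (ltW epsp) epsM2000 aM epsa rate Kstar
    gstar gP Kv.
  have Ip := @posdef1 R d.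
  have nRad x : interior K x -> lnorm 1%:M x <= Rad.
    by move=> /interior_subset/KRad; rewrite enormE.
  (* [w] may be so close to the boundary that [Phi] is huge there. Comparing with [v] instead costs
     [2 Rad G / T] per round, hence [2 Rad G] in total. *)
  have vw t : (t < T)%N -> dotv (g t) (v - w) <= 2 * (Rad * G) * tau^-1.
    move=> tT; have -> : v - w = tau^-1 *: (wstar - w).
      apply/matrixP => i j; rewrite !mxE; ring.
    rewrite dotvZr [leRHS]mulrC ler_wpM2l ?(ltW ti0)//.
    apply: le_trans (ler_norm _) _.
    have := cauchy_schwarz (g t) (wstar - w) Ip; rewrite /bform mul1mx => h.
    apply: le_trans h _; rewrite (_ : 2 * (Rad * G) = G * (2 * Rad)); last by ring.
    apply: ler_pM; rewrite ?lnorm_ge0// -?enormE; first exact: gG.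
    rewrite enormE; apply: le_trans (lnormD _ _ Ip) _; rewrite lnormN mulr_natl mulr2n.
    by apply: lerD; exact: nRad.
  have lt_le t : (t < T)%N -> l t (w_ t) - l t w <=
      eta^-1 * dotv (eta *: g t) (w_ t - v) + 2 * (Rad * G) * tau^-1.
    move=> tT; have := lsub t tT w (interior_subset Kw).
    have := vw t tT; rewrite dotvZl mulKf ?gt_eqF//.
    rewrite -/w_ !dotvBr; move: (dotv _ _) (dotv _ _) (dotv _ _) (l t _) (l t _).
    by clear => *; lra.
  have sum_le : \sum_(t < T) (l t (w_ t) - l t w) <=
      eta^-1 * (\sum_(t < T) dotv (eta *: g t) (w_ t - v)) + 2 * (Rad * G).
    apply: le_trans (ler_sum _ (fun (t : 'I_T) _ => lt_le t (ltn_ord t))) _.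
    rewrite big_split /= -mulr_sumr sumr_const card_ord lerD2l.
    by rewrite -[_ *+ T]mulr_natr tauE mulfVK// gt_eqF.
  apply: le_trans sum_le _.
  (* The parameter of [v] is [1 - 1 / tau], so the barrier grows by at most [nu ln tau]; the
     quadratic term adds at most [c / 2 * Rad^2 = nu / 2]. *)
  have Phi_le : Psi v + c / 2 * dotv v v - (Psi wstar + c / 2 * dotv wstar wstar)
      <= nu * ln tau + nu / 2.
    have := barrier_ln_le cK psiS sn0 psiB Kstar Kw s01; rewrite -/v.
    rewrite subKr lnV ?posrE// sqr_sqrtr ?(ltW nu0)// mulrN opprK.
    have vv : dotv v v <= Rad ^+ 2.
      rewrite -qform1 -sqr_lnorm// lerXn2r ?nnegrE ?lnorm_ge0 ?(ltW Rad0)//; exact: nRad.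
    have c2p : 0 <= c / 2 by rewrite divr_ge0// ltW.
    have := ler_wpM2l c2p vv; have := mulr_ge0 c2p (dotv_ge0 wstar).
    have -> : c / 2 * Rad ^+ 2 = nu / 2 by rewrite /c; field; rewrite gt_eqF.
    by move: (c / 2 * _) (c / 2 * _) (Psi _) (Psi _) (nu * _); clear => *; lra.
  have X_le := @regret_numeric R nu Rad G tau (ln tau) a eps
    (eta^-1 * (\sum_(t < T) dotv (eta *: g t) (w_ t - v))) nu0 Rad0 G0 tau1 l1 eps2 erefl.
  rewrite -/S -etaD in X_le.
  have Q1 : 1 <= Num.sqrt (tau * ln tau).
    by rewrite -[leLHS]sqrtr1 ler_wsqrtr// -[leLHS]mulr1; apply: ler_pM.
  have RG0 : 0 < Rad * G by rewrite mulr_gt0.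
  have := ler_wpM2l (ltW RG0) Q1; have := mulr_ge0 (ltW RG0) (sqrtr_ge0 (tau * ln tau)).
  move=> RQ0 RQ1.
  have {}X_le : eta^-1 * (\sum_(t < T) dotv (eta *: g t) (w_ t - v)) <=
      426 * (Rad * G * Num.sqrt (tau * ln tau)).
    apply: X_le; rewrite mulVKf ?gt_eqF//; apply: le_trans reg _; rewrite tauE.
    by rewrite -addrA [leRHS]addrAC -addrA [X in _ <= _ + X]addrC lerD2r.
  have RQ : 0 <= c2 * (Rad * G * Num.sqrt (tau * ln tau)).
    by rewrite !mulr_ge0 ?sqrtr_ge0 ?(ltW G0) ?(ltW Rad0)//; move: c2_ge; clear; lra.
  rewrite mulr1 in RQ1; move: X_le RQ RQ0 RQ1.
  move: (eta^-1 * _) (Rad * G * Num.sqrt (tau * ln tau)) (Rad * G) => b1 b2 b3.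
  by clear; lra.
- move=> nuT.
  have [_ [k cost_k k_le] _] := run T (leqnn T).
  have {}k_le : k%:R * (M^-1 / 41) <= tau * (11 * a).
    by rewrite -tauE; apply: le_trans k_le; rewrite lerDl lnorm_ge0.
  apply: (@cost_numeric R _ (call_cost OhPhi)%:R (call_cost OgPhi)%:R (mN.-1)%:R d%:R
    (call_cost OgP)%:R (call_cost OhP)%:R k%:R c2 M nu tau (ln tau) a L) => //.
  (* Since [eps^2 = nu / tau], the ratio of [tau / (nu M)] to [1 / (eps M)] is [1 / eps]. It is at
     least 1 because [nu <= tau]. *)
  + rewrite ler_ln ?posrE ?divr_gt0 ?mulr_gt0//.
    have eps1 : eps <= 1.
      by rewrite epsD -[leRHS]sqrtr1; apply: ler_wsqrtr; rewrite ler_pdivrMr// mul1r.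
    rewrite ler_pdivrMr//.
    have -> : tau / (nu * M) * (eps * M) = eps^-1 * (tau / nu * eps ^+ 2).
      by field; rewrite !gt_eqF.
    by rewrite eps2 mulrA divfK ?gt_eqF// divff ?gt_eqF// mulr1 invf_ge1.
  + apply: le_trans mN_le; rewrite ler_nat; exact: leq_pred.
  + by clear -c2_ge; lra.
  + by rewrite ler1n.
  + by rewrite -natrD ler_nat.
  + by rewrite -natrD ler_nat.
  have := cost_k; rewrite -(ler_nat R) => h; apply: le_trans h _.
  by rewrite /round_cost !(natrD, natrM, natrX) tauE.
Qed.
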